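(* Let $w$ be a Robinsonian graphon satisfying Assumptions (A1)–(A4). Then the eigenspace of the graphon-Laplacian $\mathbb{L}$ corresponding to the Fiedler value $\lambda_2$ is one-dimensional.
   Context: A graphon is a measurable symmetric function $w:[0,1]^2\to[0,1]$. It is Robinsonian if for all $x,y,z\in[0,1]$: $y<z<x\Rightarrow w(x,y)\le w(x,z)$ and $x<y<z\Rightarrow w(x,y)\ge w(x,z)$. The degree function is $d(x)=\int_0^1 w(x,y)\,dy$. The graphon-Laplacian is the bounded self-adjoint positive operator on $L^2([0,1])$ given by $(\mathbb{L}f)(x)=\int_0^1 w(x,y)(f(x)-f(y))\,dy$. The isolated eigenvalues of finite multiplicity of $\mathbb{L}$ are listed increasingly as $0=\lambda_1<\lambda_2<\lambda_3<\cdots$; $\lambda_2$ is the Fiedler value. Assumptions: (A1) there is $K>0$ with $|w(x,y)-w(x',y')|\le K(|x-x'|+|y-y'|)$; (A2) for every $x$, $\partial w(x,y)/\partial x$ exists and is non-zero for almost every $y$; (A3) $d'(x)$ exists for all $x\in[0,1]$ and $\{x: d'(x)=0\}$ is countable; (A4) with $\mathcal{H}=\{f\in L^2([0,1]):\int_0^1 f=0,\ \int_0^1 f^2=1\}$, $\inf_{f\in\mathcal{H}}\langle \mathbb{L}f,f\rangle<\inf_{x\in[0,1]}d(x)$. *)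

(* Defs.v *)
From HB Require Import structures.
From mathcomp Require Import all_boot all_order all_algebra.
From mathcomp Require Import all_classical all_reals all_analysis.
Set Implicit Arguments. Unset Strict Implicit. Unset Printing Implicit Defensive.
Import Order.TTheory GRing.Theory Num.Theory.
Import numFieldNormedType.Exports.
Local Open Scope classical_set_scope.
Local Open Scope ring_scope.

Section Graphon.
Variable R : realType.

Definition I01 : set R := `[0%R, 1%R].

Notation leb := (@lebesgue_measure R).

(* f is in L^2([0,1]) (a representative of an L^2 class). *)
Definition L2 (f : R -> R) : Prop :=
  measurable_fun I01 f /\ leb.-integrable I01 (fun x => ((f x) ^+ 2)%:E).

Definition ae_eq (f g : R -> R) : Prop :=
  {ae leb, forall x, I01 x -> f x = g x}.

Definition graphon (w : R -> R -> R) : Prop :=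
  measurable_fun (I01 `*` I01) (fun p : R * R => w p.1 p.2) /\
  (forall x y, I01 x -> I01 y -> w x y = w y x) /\
  (forall x y, I01 x -> I01 y -> 0 <= w x y <= 1).

Definition robinsonian (w : R -> R -> R) : Prop :=
  forall x y z, I01 x -> I01 y -> I01 z ->
    ((y < z < x) -> w x y <= w x z) /\ ((x < y < z) -> w x z <= w x y).

Definition degree (w : R -> R -> R) (x : R) : R :=
  \int[leb]_(y in I01) w x y.

Definition lap (w : R -> R -> R) (f : R -> R) (x : R) : R :=
  \int[leb]_(y in I01) (w x y * (f x - f y)).

Definition ip (f g : R -> R) : R := \int[leb]_(x in I01) (f x * g x).

(* derivative of f at x (relative to [0,1], i.e. one-sided at endpoints) equals l *)
Definition derivI (f : R -> R) (x l : R) : Prop :=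
  (fun t => (f t - f x) / (t - x)) @ within I01 x^' --> l.

Definition A1 (w : R -> R -> R) : Prop :=
  exists K : R, 0 < K /\ forall x y x' y', I01 x -> I01 y -> I01 x' -> I01 y' ->
    `|w x y - w x' y'| <= K * (`|x - x'| + `|y - y'|).

Definition A2 (w : R -> R -> R) : Prop :=
  forall x, I01 x ->
    {ae leb, forall y, I01 y -> exists l, derivI (fun t => w t y) x l /\ l != 0}.

Definition A3 (w : R -> R -> R) : Prop :=
  (forall x, I01 x -> exists l, derivI (degree w) x l) /\
  countable [set x | I01 x /\ derivI (degree w) x 0].

Definition Hset (f : R -> R) : Prop :=
  L2 f /\ \int[leb]_(x in I01) f x = 0 /\ \int[leb]_(x in I01) (f x ^+ 2) = 1.

Definition A4 (w : R -> R -> R) : Prop :=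
  inf [set ip (lap w f) f | f in Hset] < inf [set degree w x | x in I01].

(* f is an eigenfunction (possibly zero) of L for lam: element of the eigenspace *)
Definition eigfun (w : R -> R -> R) (lam : R) (f : R -> R) : Prop :=
  L2 f /\ ae_eq (lap w f) (fun x => lam * f x).

Definition ae_zero (f : R -> R) : Prop := ae_eq f (fun=> 0).

Definition eigenvalue (w : R -> R -> R) (lam : R) : Prop :=
  exists f, eigfun w lam f /\ ~ ae_zero f.

(* lam is in the resolvent set: L - lam is a bijection of L^2([0,1])
   (bounded inverse is automatic by the open mapping theorem) *)
Definition resolvent (w : R -> R -> R) (lam : R) : Prop :=
  (forall g, L2 g -> exists f, L2 f /\ ae_eq (fun x => lap w f x - lam * f x) g) /\
  (forall f, L2 f -> ae_zero (fun x => lap w f x - lam * f x) -> ae_zero f).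

Definition spectrum (w : R -> R -> R) (lam : R) : Prop := ~ resolvent w lam.

Definition isolated_fin_eigenvalue (w : R -> R -> R) (lam : R) : Prop :=
  eigenvalue w lam /\
  (exists e : R, 0 < e /\ forall mu, spectrum w mu -> `|mu - lam| < e -> mu = lam) /\
  (exists s : seq (R -> R), forall f, eigfun w lam f ->
     exists c : seq R, ae_eq f (fun x => \sum_(i < size s) c`_i * (nth (fun=> 0) s i) x)).

(* lam is the Fiedler value lambda_2: listing the isolated eigenvalues of finite
   multiplicity increasingly as 0 = lambda_1 < lambda_2 < ..., lam = lambda_2. *)
Definition fiedler_value (w : R -> R -> R) (lam : R) : Prop :=
  isolated_fin_eigenvalue w 0 /\ 0 < lam /\ isolated_fin_eigenvalue w lam /\
  (forall mu, isolated_fin_eigenvalue w mu -> mu < lam -> mu = 0).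

Definition eigenspace_dim1 (w : R -> R -> R) (lam : R) : Prop :=
  exists f0, eigfun w lam f0 /\ ~ ae_zero f0 /\
    forall f, eigfun w lam f -> exists c : R, ae_eq f (fun x => c * f0 x).

End Graphon.

(* Main.v *)
Require Import Defs.
From mathcomp Require Import all_boot all_order all_algebra.
From mathcomp Require Import all_classical all_reals all_analysis.
From mathcomp Require Import measurable_realfun ring lra.

(** Write [L = d - W] with [W] the integral operator of kernel [w].  As [W] maps
    bounded sets of [L^2] to equi-Lipschitz sets and [m < inf d], where [m] is the
    infimum of the Rayleigh quotient on the functions of mean zero, a minimizing
    sequence has a strong limit point, so [m] is attained by an eigenfunction.

    Eigenfunctions for [m] have a Lipschitz representative [f = W f / (d - m)].
    Let [F] be the total variation of [f].  The Robinson property turns the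
    eigenvalue equation into [(d - m) |df| <= (d - m) dF - du] with
    [u = (L - m) F], and as [|df|] and [dF] have the same total mass on every
    interval, [u] is nonincreasing.  Since [F] is nondecreasing, Chebyshev's
    inequality shows that the centred [F] minimizes the Rayleigh quotient, so [u]
    is constant.  If [f 0 = f 1] and [f] is not constant, then [|f y - f x|] is
    smaller than [F y - F x] for [x] near [0] and [y] near [1], and (A2) makes the
    inequality strict, a contradiction.  Hence an eigenfunction is determined by
    [f 1 - f 0], and the eigenspace of [m] is a line.

    The maximum principle and (A2) give [m <> 0].  Compactness yields a gap
    above [m] on the orthogonal of [1] and the eigenfunction, where [L - mu] can
    be inverted by minimizing the energy.  So [m] is isolated and equals the
    Fiedler value. *)

Set Implicit Arguments. Unset Strict Implicit. Unset Printing Implicit Defensive.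
Import Order.TTheory GRing.Theory Num.Theory.
Import numFieldNormedType.Exports.
Import Defs.
Local Open Scope classical_set_scope.
Local Open Scope ring_scope.

Lemma measurable_I01 (R : realType) : measurable (@I01 R).
Proof. exact: measurable_itv. Qed.

#[local] Hint Extern 0 (measurable _) => solve [exact: measurable_I01] : core.

(** * Integration and Lipschitz functions on the unit interval *)

Section UnitIntervalIntegral.
Variable R : realType.
Notation leb := (@lebesgue_measure R).
Notation I01 := (@I01 R).
Implicit Types f g h : R -> R.

Definition itg f := leb.-integrable I01 (EFin \o f).
Definition Int f := \int[leb]_(x in I01) f x.
Definition lipschitzI (C : R) f :=
  forall x y, I01 x -> I01 y -> `|f x - f y| <= C * `|x - y|.

Lemma I01E x : I01 x <-> 0 <= x <= 1.
Proof. by rewrite /Defs.I01 /= in_itv. Qed.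

Lemma lebesgue_I01 : leb I01 = 1%E.
Proof. by rewrite /Defs.I01 lebesgue_measure_itv /= lte_fin ltr01 oppr0 adde0. Qed.

Lemma lebesgue_I01_fin : (leb I01 < +oo)%E.
Proof. by rewrite lebesgue_I01 ltry. Qed.

Lemma itg_measurable f : itg f -> measurable_fun I01 f.
Proof. by move=> /integrableP[/measurable_EFinP]. Qed.

Lemma eq_Int f g : (forall x, I01 x -> f x = g x) -> Int f = Int g.
Proof. by move=> fg; apply: eq_Rintegral => x /set_mem /fg. Qed.

Lemma eq_itg f g : (forall x, I01 x -> f x = g x) -> itg f -> itg g.
Proof.
by move=> fg; apply: eq_integrable => // x /set_mem xI; rewrite /= fg.
Qed.

Lemma itgD f g : itg f -> itg g -> itg (fun x => f x + g x).
Proof. by move=> itf ig; apply: integrableD itf ig. Qed.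

Lemma itgZ a f : itg f -> itg (fun x => a * f x).
Proof. by move=> itf; apply: integrableZl itf. Qed.

Lemma itgB f g : itg f -> itg g -> itg (fun x => f x - g x).
Proof. by move=> itf ig; apply: integrableB itf ig. Qed.

Lemma itg_norm f : itg f -> itg (fun x => `|f x|).
Proof. exact: integrable_norm. Qed.

Lemma itg_le f g : measurable_fun I01 f ->
  (forall x, I01 x -> `|f x| <= g x) -> itg g -> itg f.
Proof.
move=> mf fg; apply: le_integrable => //; first exact/measurable_EFinP.
by move=> x xI; rewrite /= lee_fin (le_trans (fg _ xI))// ler_norm.
Qed.

Lemma itg_cst a : itg (fun=> a).
Proof.
apply: measurable_bounded_integrable => //.
- exact: lebesgue_I01_fin.
- by exists `|a|; split; [rewrite num_real|move=> x /ltW ax y _].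
Qed.

Lemma IntD f g : itg f -> itg g -> Int (fun x => f x + g x) = Int f + Int g.
Proof. exact: RintegralD. Qed.

Lemma IntB f g : itg f -> itg g -> Int (fun x => f x - g x) = Int f - Int g.
Proof. exact: RintegralB. Qed.

Lemma IntZ a f : itg f -> Int (fun x => a * f x) = a * Int f.
Proof. exact: RintegralZl. Qed.

Lemma Int_cst a : Int (fun=> a) = a.
Proof.
transitivity (a * fine (leb I01)); last by rewrite lebesgue_I01 mulr1.
exact: Rintegral_cst.
Qed.

Lemma Int_ge0 f : (forall x, I01 x -> 0 <= f x) -> 0 <= Int f.
Proof. by move=> f0; rewrite /Int; apply: Rintegral_ge0. Qed.

Lemma Int_le f g : itg f -> itg g -> (forall x, I01 x -> f x <= g x) ->
  Int f <= Int g.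
Proof. by move=> *; rewrite /Int; apply: le_Rintegral. Qed.

Lemma Int_norm f : itg f -> `|Int f| <= Int (fun x => `|f x|).
Proof. by move=> *; rewrite /Int; apply: le_normr_Rintegral. Qed.

Lemma Int_norm_le f g : itg f -> itg g -> (forall x, I01 x -> `|f x| <= g x) ->
  `|Int f| <= Int g.
Proof.
move=> itf ig fg; apply: le_trans (Int_norm itf) _.
by apply: Int_le => //; exact: itg_norm.
Qed.

Lemma Int_ae_eq f g : measurable_fun I01 f -> measurable_fun I01 g ->
  ae_eq f g -> Int f = Int g.
Proof.
move=> mf mg fg; congr fine; apply: ae_eq_integral => //.
- exact/measurable_EFinP.
- exact/measurable_EFinP.
- case: fg => N [mN N0 sN]; exists N; split => // x /= nx.
  by apply: sN => /= fgx; apply: nx => /fgx ->.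
Qed.

Lemma ae_mono2 (P Q S : R -> Prop) : {ae leb, forall x, I01 x -> P x} ->
  {ae leb, forall x, I01 x -> Q x} -> (forall x, I01 x -> P x -> Q x -> S x) ->
  {ae leb, forall x, I01 x -> S x}.
Proof.
move=> [N [mN N0 sN]] [M [mM M0 sM]] PQS; exists (N `|` M); split.
- exact: measurableU.
- exact: (null_set_setU mN mM N0 M0).
- move=> x /= nS; apply: contrapT => /not_orP[nN nM]; apply: nS => xI.
  apply: PQS => //; apply: contrapT => nP.
  + by apply: nN; apply: sN => /= /(_ xI).
  + by apply: nM; apply: sM => /= /(_ xI).
Qed.

Lemma ae_mono (P Q : R -> Prop) : {ae leb, forall x, I01 x -> P x} ->
  (forall x, I01 x -> P x -> Q x) -> {ae leb, forall x, I01 x -> Q x}.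
Proof. by move=> P_ PQ; apply: (ae_mono2 P_ P_) => x xI ? _; exact: PQ. Qed.

(** Otherwise the exceptional null set would contain []a, b[], whose measure is [b - a]. *)
Lemma ae_meets_interval (P : R -> Prop) a b :
  {ae leb, forall y, I01 y -> P y} -> 0 <= a -> a < b -> b <= 1 ->
  exists y, [/\ a < y, y < b & P y].
Proof.
move=> [N [mN N0 PN]] a0 ab b1.
apply: contrapT => nP.
have abN : `]a, b[%classic `<=` N.
  move=> y /=; rewrite in_itv /= => /andP[ay yb]; apply: PN => /= Py.
  apply: nP; exists y; split => //; apply: Py; apply/I01E; lra.
have : (leb `]a, b[ <= leb N)%E by apply: le_measure; rewrite ?inE.
rewrite N0 lebesgue_measure_itv /= lte_fin ab -EFinD lee_fin; lra.
Qed.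

Lemma lipschitzI_ge0 C f : lipschitzI C f -> 0 <= C.
Proof.
move=> /(_ 1 0); rewrite subr0 normr1 mulr1 => /(_ _ _)/le_trans; move=> H.
by apply: le_trans (normr_ge0 (f 1 - f 0)) (H _ _ _ _) => //; apply/I01E; lra.
Qed.

Lemma lipschitzI_bound C f x : lipschitzI C f -> I01 x -> `|f x| <= `|f 0| + C.
Proof.
move=> lf xI; have C0 := lipschitzI_ge0 lf.
have I0 : I01 0 by apply/I01E; lra.
have := lf _ _ xI I0; rewrite subr0 => fx.
have -> : f x = f 0 + (f x - f 0) by lra.
apply: le_trans (ler_normD _ _) _; rewrite lerD2l (le_trans fx)//.
by move/I01E : xI => /andP[x0 x1]; rewrite ger0_norm// ler_piMr.
Qed.

Lemma lipschitzI_continuous C f : lipschitzI C f -> {within I01, continuous f}.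
Proof.
move=> lf; apply/subspace_continuousP => x xI; apply/cvgrPdist_lt => e e0.
have C0 := lipschitzI_ge0 lf.
have C1 : 0 < C + 1 by lra.
have Fe : (within I01 (nbhs x)) (fun y => `|x - y| < e / (C + 1)).
  have : nbhs x (ball x (e / (C + 1))) by exact: nbhsx_ballx (divr_gt0 e0 C1).
  by apply: filterS => y xy _.
have FI : (within I01 (nbhs x)) I01 by exact: withinT.
near=> y; have yI : I01 y by near: y.
apply: le_lt_trans (lf _ _ xI yI) _.
have xy : `|x - y| < e / (C + 1) by near: y.
apply: le_lt_trans (_ : (C + 1) * `|x - y| < e).
  by rewrite ler_wpM2r//; lra.
by rewrite mulrC -ltr_pdivlMr.
Unshelve. all: by end_near. Qed.

Lemma lipschitzI_measurable C f : lipschitzI C f -> measurable_fun I01 f.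
Proof.
by move=> /lipschitzI_continuous; apply: subspace_continuous_measurable_fun.
Qed.

Lemma bounded_itg (M : R) f : measurable_fun I01 f ->
  (forall x, I01 x -> `|f x| <= M) -> itg f.
Proof. by move=> mf fM; apply: itg_le (itg_cst M). Qed.

Lemma lipschitzI_itg C f : lipschitzI C f -> itg f.
Proof.
move=> lf; apply: (@bounded_itg (`|f 0| + C)); first exact: lipschitzI_measurable lf.
by move=> x; exact: lipschitzI_bound.
Qed.

Lemma lipschitzI_cst a : lipschitzI 0 (fun=> a).
Proof. by move=> x y _ _; rewrite subrr normr0 mul0r. Qed.

Lemma lipschitzI_lin C D f g a b : lipschitzI C f -> lipschitzI D g ->
  lipschitzI (`|a| * C + `|b| * D) (fun x => a * f x + b * g x).
Proof.
move=> lf lg x y xI yI.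
have -> : a * f x + b * g x - (a * f y + b * g y) = a * (f x - f y) + b * (g x - g y) by ring.
apply: le_trans (ler_normD _ _) _; rewrite !normrM mulrDl -!mulrA.
by apply: lerD; rewrite ler_wpM2l// ?lf ?lg.
Qed.

Lemma lipschitzIM C D f g : lipschitzI C f -> lipschitzI D g ->
  exists E, lipschitzI E (fun x => f x * g x).
Proof.
move=> lf lg; exists ((`|f 0| + C) * D + (`|g 0| + D) * C) => x y xI yI.
have -> : f x * g x - f y * g y = f x * (g x - g y) + g y * (f x - f y) by ring.
apply: le_trans (ler_normD _ _) _; rewrite !normrM mulrDl -!mulrA.
by apply: lerD; apply: ler_pM; rewrite ?normr_ge0// ?lf ?lg//;
  apply: lipschitzI_bound.
Qed.

(** A nonzero value at [x] keeps [f] away from 0 on a whole interval next to [x]. This turns almost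
    everywhere identities between Lipschitz functions into pointwise ones. *)
Lemma lipschitzI_ae0 C f : lipschitzI C f -> ae_zero f -> forall x, I01 x -> f x = 0.
Proof.
move=> lf f0 x xI; apply/eqP/negP => /negP fx0.
have C0 := lipschitzI_ge0 lf.
have e0 : 0 < `|f x| / (C + 1) by rewrite divr_gt0 ?normr_gt0//; lra.
(* [C + 1] allows for [C = 0]; the cap 1/2 lets an interval of length [e] fit in the unit interval
   on one side of [x]. *)
pose e := Num.min (`|f x| / (C + 1)) (1 / 2).
have [e_gt0 eC e1] : [/\ 0 < e, e <= `|f x| / (C + 1) & e <= 1/2].
  rewrite /e; split; first by rewrite lt_min e0; lra.
  - by rewrite ge_min lexx.
  - by rewrite ge_min lexx orbT.
have near y : I01 y -> `|x - y| < e -> f y = 0 -> False.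
  move=> yI xy fy; have := lf _ _ xI yI; rewrite fy subr0 leNgt => /negP; apply.
  apply: le_lt_trans (_ : (C + 1) * `|x - y| < _).
    by rewrite ler_wpM2r//; lra.
  by rewrite mulrC -ltr_pdivlMr ?(lt_le_trans xy)//; lra.
move/I01E: (xI) => /andP[x0 x1].
have [x2|x2] := leP x (1/2).
- have [||//|y [xy yx fy]] := @ae_meets_interval _ x (x + e) f0; [lra..|].
  apply: (near y) fy; first by apply/I01E; lra.
  by rewrite ltr_norml; lra.
- have [||//|y [xy yx fy]] := @ae_meets_interval _ (x - e) x f0; [lra..|].
  apply: (near y) fy; first by apply/I01E; lra.
  by rewrite ltr_norml; lra.
Qed.

Lemma Int_abs_eq0 f : itg f -> (forall x, I01 x -> 0 <= f x) -> Int f = 0 -> ae_zero f.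
Proof.
move=> itf f0 If; have mf := itg_measurable itf.
have fin : (\int[leb]_(x in I01) (f x)%:E \is a fin_num)%E.
  by apply: integrable_fin_num itf.
have I0 : (\int[leb]_(x in I01) `|(f x)%:E| = 0)%E.
  have -> : (\int[leb]_(x in I01) `|(f x)%:E| = \int[leb]_(x in I01) (f x)%:E)%E.
    by apply: eq_integral => x /set_mem /f0 fx; rewrite /= ger0_norm.
  by move: If; rewrite -(fineK fin) /Int /Rintegral => ->.
have mE : measurable_fun I01 (EFin \o f) by exact/measurable_EFinP.
have [] : measure_negligible.ae_eq leb I01 (EFin \o f) (cst 0%E).
  by apply/ae_eq_integral_abs.
move=> N [mN N0 sN]; exists N; split => // x /= fx.
by apply: sN => /= fx'; apply: fx => /fx'[].
Qed.

Lemma lipschitzI_Int0 C f : lipschitzI C f -> (forall x, I01 x -> 0 <= f x) ->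
  Int f = 0 -> forall x, I01 x -> f x = 0.
Proof.
move=> lf f0 If; apply: (lipschitzI_ae0 lf).
by apply: Int_abs_eq0 => //; exact: lipschitzI_itg lf.
Qed.

End UnitIntervalIntegral.

(** * Square-integrable functions and the form [ip] *)

Section L2Space.
Variable R : realType.
Notation leb := (@lebesgue_measure R).
Notation I01 := (@I01 R).
Implicit Types f g h : R -> R.

Lemma measurable_lin a b f g : measurable_fun I01 f -> measurable_fun I01 g ->
  measurable_fun I01 (fun x => a * f x + b * g x).
Proof.
move=> mf mg; apply: measurable_funD; apply: measurable_funM => //;
  exact: measurable_cst.
Qed.

Lemma L2_sq f : L2 f -> itg (fun x => f x ^+ 2).
Proof. by case. Qed.

Lemma L2_measurable f : L2 f -> measurable_fun I01 f.
Proof. by case. Qed.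

Lemma eq_L2 f g : (forall x, I01 x -> f x = g x) -> L2 f -> L2 g.
Proof.
move=> fg [mf f2]; split.
- by apply: eq_measurable_fun mf => x /set_mem /fg.
- by apply: (@eq_itg _ (fun x => f x ^+ 2)) f2 => x /fg ->.
Qed.

Lemma L2_itgM f g : L2 f -> L2 g -> itg (fun x => f x * g x).
Proof.
move=> [mf f2] [mg g2]; apply: itg_le (itgD f2 g2).
- exact: measurable_funM.
- move=> x _; rewrite normrM -(real_normK (num_real (f x))) -(real_normK (num_real (g x))).
  have := sqr_ge0 (`|f x| - `|g x|); have := normr_ge0 (f x); have := normr_ge0 (g x).
  nra.
Qed.

Lemma L2_lin a b f g : L2 f -> L2 g -> L2 (fun x => a * f x + b * g x).
Proof.
move=> lf lg; split; first exact: measurable_lin lf.1 lg.1.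
apply: (@eq_itg _ (fun x => a ^+ 2 * f x ^+ 2 + ((2 * a * b) * (f x * g x) + b ^+ 2 * g x ^+ 2))).
  by move=> x _; ring.
by apply: itgD; [|apply: itgD]; apply: itgZ; [exact: L2_sq|exact: L2_itgM|exact: L2_sq].
Qed.

Lemma L2_mulb (M : R) h f : measurable_fun I01 h ->
  (forall x, I01 x -> `|h x| <= M) -> L2 f -> L2 (fun x => h x * f x).
Proof.
move=> mh hM [mf f2]; split; first exact: measurable_funM.
apply: (@itg_le _ _ (fun x => M ^+ 2 * f x ^+ 2)); last exact: itgZ.
  by apply: measurable_funX; exact: measurable_funM.
move=> x xI; rewrite exprMn normrM !normrX ler_pM ?exprn_ge0//.
  by rewrite lerXn2r ?nnegrE ?(le_trans _ (hM x xI)) ?hM.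
by rewrite real_normK ?num_real.
Qed.

Lemma lipschitzI_L2 C f : lipschitzI C f -> L2 f.
Proof.
move=> lf; split; first exact: lipschitzI_measurable lf.
by have [E lE] := lipschitzIM lf lf; exact: lipschitzI_itg lE.
Qed.

Lemma L2_cst a : L2 (fun=> a : R).
Proof. exact: lipschitzI_L2 (lipschitzI_cst a). Qed.

Lemma L2_itg f : L2 f -> itg f.
Proof.
by move=> lf; apply: eq_itg (L2_itgM lf (L2_cst 1)) => x _; rewrite mulr1.
Qed.

Lemma L2Z a f : L2 f -> L2 (fun x => a * f x).
Proof.
by move=> lf; apply: eq_L2 (L2_lin a 0 lf lf) => x _; rewrite mul0r addr0.
Qed.

Lemma L2B f g : L2 f -> L2 g -> L2 (fun x => f x - g x).
Proof. by move=> lf lg; apply: eq_L2 (L2_lin 1 (-1) lf lg) => x _; ring. Qed.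

Lemma ipC f g : ip f g = ip g f.
Proof. by apply: eq_Int => x _; rewrite mulrC. Qed.

Lemma eq_ip f f' g : (forall x, I01 x -> f x = f' x) -> ip f g = ip f' g.
Proof. by move=> ff'; apply: eq_Int => x xI; rewrite ff'. Qed.

Lemma ip_ae f f' g : measurable_fun I01 f -> measurable_fun I01 f' ->
  measurable_fun I01 g -> ae_eq f f' -> ip f g = ip f' g.
Proof.
move=> mf mf' mg ff'; apply: Int_ae_eq; [exact: measurable_funM..|].
by rewrite /ae_eq; apply: (ae_mono ff') => x _ ->.
Qed.

Lemma ip_lin a b f g h : L2 f -> L2 g -> L2 h ->
  ip (fun x => a * f x + b * g x) h = a * ip f h + b * ip g h.
Proof.
move=> lf lg lh.
have [fh gh] := (L2_itgM lf lh, L2_itgM lg lh).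
rewrite -(IntZ a fh) -(IntZ b gh) -IntD; [|exact: itgZ..].
by apply: eq_Int => x _; ring.
Qed.

Lemma ipBl f g h : L2 f -> L2 g -> L2 h ->
  ip (fun x => f x - g x) h = ip f h - ip g h.
Proof.
move=> lf lg lh; transitivity (1 * ip f h + (-1) * ip g h); last by ring.
by rewrite -ip_lin//; apply: eq_ip => x _; ring.
Qed.

Lemma ipZl a f h : L2 f -> L2 h -> ip (fun x => a * f x) h = a * ip f h.
Proof.
move=> lf lh; rewrite -(IntZ a (L2_itgM lf lh)).
by apply: eq_Int => x _; ring.
Qed.

Lemma ip_sq_lin a b f g : L2 f -> L2 g ->
  ip (fun x => a * f x + b * g x) (fun x => a * f x + b * g x) =
  a ^+ 2 * ip f f + 2 * a * b * ip f g + b ^+ 2 * ip g g.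
Proof.
move=> lf lg; have lh := L2_lin a b lf lg.
rewrite ip_lin// ![ip _ (fun x => _ + _)]ipC !ip_lin// (ipC g f); ring.
Qed.

Lemma ip_ge0 f : 0 <= ip f f.
Proof. by apply: Int_ge0 => x _; rewrite -expr2 sqr_ge0. Qed.

Lemma ip_eq0 f : L2 f -> ip f f = 0 -> ae_zero f.
Proof.
move=> lf f0; have := Int_abs_eq0 (L2_itgM lf lf) _ f0.
move=> /(_ _)/ae_mono; apply; first by move=> x _; rewrite -expr2 sqr_ge0.
by move=> x _ /eqP; rewrite mulf_eq0 orbb => /eqP.
Qed.

(** Expand the square of [t * f - g] and divide by [t]. *)
Lemma ip_young t f g : 0 < t -> L2 f -> L2 g ->
  2 * ip f g <= t * ip f f + t^-1 * ip g g.
Proof.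
move=> t0 lf lg; have := ip_ge0 (fun x => t * f x + (-1) * g x).
rewrite ip_sq_lin// => H.
have -> : t * ip f f + t^-1 * ip g g = t^-1 * (t ^+ 2 * ip f f + ip g g).
  by field; lra.
by rewrite ler_pdivlMl//; lra.
Qed.

Lemma ip1E f : ip f (fun=> 1) = Int f.
Proof. by apply: eq_Int => x _; rewrite mulr1. Qed.

(** The difference of the two sides is the integral of the square of [f] minus its mean. *)
Lemma Int_sq_le f : L2 f -> Int f ^+ 2 <= ip f f.
Proof.
move=> lf; have := ip_ge0 (fun x => 1 * f x + (- Int f) * 1).
rewrite (ip_sq_lin 1 (- Int f) lf (L2_cst 1)) ip1E.
have -> : ip (fun=> 1) (fun=> 1) = 1 :> R by rewrite ip1E Int_cst.
lra.
Qed.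

Lemma L2_norm f : L2 f -> L2 (fun x => `|f x|).
Proof.
move=> [mf f2]; split; first exact: measurableT_comp.
by apply: (@eq_itg _ (fun x => f x ^+ 2)) f2 => x _; rewrite real_normK ?num_real.
Qed.

Lemma ip_norm f : ip (fun x => `|f x|) (fun x => `|f x|) = ip f f.
Proof. by apply: eq_Int => x _; rewrite -!expr2 real_normK ?num_real. Qed.

Lemma Int_norm_sq_le f : L2 f -> Int (fun x => `|f x|) ^+ 2 <= ip f f.
Proof. by move=> lf; rewrite -ip_norm; apply: Int_sq_le; exact: L2_norm. Qed.

Lemma Int_norm_ge0 f : 0 <= Int (fun x => `|f x|).
Proof. exact: Int_ge0. Qed.

End L2Space.

(** * The integral operator [W] ([kop]) and the graphon-Laplacian *)

Section Operator.
Variable R : realType.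
Notation leb := (@lebesgue_measure R).
Notation I01 := (@I01 R).
Implicit Types f g h : R -> R.
Variable w : R -> R -> R.
Hypothesis gw : graphon w.
Variable K : R.
Hypothesis lw : forall x y x' y', I01 x -> I01 y -> I01 x' -> I01 y' ->
    `|w x y - w x' y'| <= K * (`|x - x'| + `|y - y'|).

Definition kop f x := Int (fun y => w x y * f y).

Let wsym x y : I01 x -> I01 y -> w x y = w y x.
Proof. exact: gw.2.1. Qed.
Let w01 x y : I01 x -> I01 y -> 0 <= w x y <= 1.
Proof. exact: gw.2.2. Qed.

Lemma graphon_norm x y : I01 x -> I01 y -> `|w x y| <= 1.
Proof. by move=> xI yI; have /andP[w0 w1] := w01 xI yI; rewrite ger0_norm. Qed.

Lemma graphon_row_lip x : I01 x -> lipschitzI K (w x).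
Proof.
move=> xI y y' yI yI'; apply: le_trans (lw _ _ _ _) _ => //.
by rewrite subrr normr0 add0r.
Qed.

Lemma graphon_col_lip y : I01 y -> lipschitzI K (w^~ y).
Proof.
move=> xI x x' yI yI'; apply: le_trans (lw _ _ _ _) _ => //.
by rewrite subrr normr0 addr0.
Qed.

Lemma itg_kernel f x : I01 x -> itg f -> itg (fun y => w x y * f y).
Proof.
move=> xI itf; apply: itg_le (itg_norm itf).
- apply: measurable_funM; last exact: itg_measurable.
  exact: lipschitzI_measurable (graphon_row_lip xI).
- by move=> y yI; rewrite normrM ler_piMl// graphon_norm.
Qed.

(** The constant depends on [f] only through its L1 norm, so [kop] sends bounded sets to
    equi-Lipschitz sets: the source of all compactness below. *)
Lemma kop_lip f : itg f -> lipschitzI (K * Int (fun y => `|f y|)) (kop f).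
Proof.
move=> itf x x' xI xI'; rewrite /kop -IntB; [|exact: itg_kernel..].
rewrite mulrAC -IntZ; last exact: itg_norm.
apply: Int_norm_le; [by apply: itgB; exact: itg_kernel| exact/itgZ/itg_norm|].
by move=> y yI; rewrite -mulrBl normrM ler_wpM2r// graphon_col_lip.
Qed.

Lemma kop_bound f x : I01 x -> itg f -> `|kop f x| <= Int (fun y => `|f y|).
Proof.
move=> xI itf; apply: Int_norm_le; [exact: itg_kernel|exact: itg_norm|].
by move=> y yI; rewrite normrM ler_piMl// graphon_norm.
Qed.

Lemma degreeE x : degree w x = kop (fun=> 1) x.
Proof. by apply: eq_Int => y _; rewrite mulr1. Qed.

Lemma degree_lip : lipschitzI K (degree w).
Proof.
move=> x y xI yI; rewrite !degreeE.
apply: le_trans (kop_lip (itg_cst 1) xI yI) _.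
by under eq_Int do rewrite normr1; rewrite Int_cst mulr1.
Qed.

Lemma degree_ge0 x : I01 x -> 0 <= degree w x.
Proof. by move=> xI; apply: Int_ge0 => y yI; case/andP: (w01 xI yI). Qed.

Lemma degree_le1 x : I01 x -> degree w x <= 1.
Proof.
move=> xI; rewrite -[leRHS](@Int_cst R); apply: Int_le; [|exact: itg_cst|].
- exact: lipschitzI_itg (graphon_row_lip xI).
- by move=> y yI; case/andP: (w01 xI yI).
Qed.

Lemma lapE f x : itg f -> I01 x -> lap w f x = degree w x * f x - kop f x.
Proof.
move=> itf xI; rewrite [_ * f x]mulrC.
have itw := lipschitzI_itg (graphon_row_lip xI).
rewrite -[degree w x]/(Int (w x)) -IntZ// /kop -IntB; [|exact: itgZ|exact: itg_kernel].
by apply: eq_Int => y _; ring.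
Qed.

Lemma kop_L2 f : itg f -> L2 (kop f).
Proof. by move=> /kop_lip; exact: lipschitzI_L2. Qed.

Lemma degreeM_L2 f : L2 f -> L2 (fun x => degree w x * f x).
Proof.
apply: (@L2_mulb _ 1); first exact: lipschitzI_measurable degree_lip.
by move=> x xI; rewrite ger0_norm ?degree_ge0 ?degree_le1.
Qed.

Lemma lap_L2 f : L2 f -> L2 (lap w f).
Proof.
move=> lf; have itf := L2_itg lf.
apply: (@eq_L2 _ (fun x => degree w x * f x - kop f x)).
  by move=> x xI; rewrite lapE.
by apply: L2B; [exact: degreeM_L2|exact: kop_L2].
Qed.

Lemma kop_lin a b f g x : I01 x -> itg f -> itg g ->
  kop (fun y => a * f y + b * g y) x = a * kop f x + b * kop g x.
Proof.
move=> xI itf ig; rewrite /kop -!IntZ -?IntD; try exact/itgZ/itg_kernel; try exact: itg_kernel.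
by apply: eq_Int => y _; ring.
Qed.

Lemma lap_lin a b f g x : I01 x -> itg f -> itg g ->
  lap w (fun y => a * f y + b * g y) x = a * lap w f x + b * lap w g x.
Proof.
move=> xI itf ig; rewrite !lapE// ?kop_lin//; last exact: itgD (itgZ _ _) (itgZ _ _).
by ring.
Qed.

Lemma eq_kop f g x : (forall y, I01 y -> f y = g y) -> kop f x = kop g x.
Proof. by move=> fg; apply: eq_Int => y yI; rewrite fg. Qed.

Lemma kop_ae f g x : I01 x -> itg f -> itg g -> ae_eq f g -> kop f x = kop g x.
Proof.
move=> xI itf ig fg; apply: Int_ae_eq; [by apply: itg_measurable; exact: itg_kernel..|].
by rewrite /ae_eq; apply: (ae_mono fg) => y _ ->.
Qed.

Lemma kop_ip_le f : L2 f -> `|ip (kop f) f| <= ip f f.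
Proof.
move=> lf; have itf := L2_itg lf.
apply: le_trans (Int_norm_sq_le lf); rewrite expr2 -IntZ; last exact: itg_norm.
apply: Int_norm_le; [by apply: L2_itgM => //; exact: kop_L2|exact/itgZ/itg_norm|].
by move=> x xI; rewrite normrM ler_wpM2r// kop_bound.
Qed.

Lemma lap_ip f g : L2 f -> L2 g ->
  ip (lap w f) g = ip (fun x => degree w x * f x) g - ip (kop f) g.
Proof.
move=> lf lg; have itf := L2_itg lf.
rewrite -ipBl//; [|exact: degreeM_L2|exact: kop_L2].
by apply: eq_ip => x xI; rewrite lapE.
Qed.

(** Multiplication by [d] and the operator [W] contribute at most [ip f f] each. *)
Lemma lap_ip_le f : L2 f -> `|ip (lap w f) f| <= 2 * ip f f.
Proof.
move=> lf; rewrite lap_ip//; apply: le_trans (ler_normB _ _) _.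
have := kop_ip_le lf; set a := `|_|; set b := `|_| => ab.
suff : b <= ip f f by lra.
apply: Int_norm_le; [apply: L2_itgM => //; exact: degreeM_L2|exact: L2_itgM|].
move=> x xI; rewrite -mulrA normrM -expr2 [`|_ ^+ 2|]ger0_norm ?sqr_ge0//.
by rewrite ler_piMl ?sqr_ge0// ger0_norm ?degree_ge0 ?degree_le1.
Qed.

(** Fubini for [w x y * (f y * g x)]: the two iterated integrals are the two sides, by the symmetry
    of [w]. *)
Lemma kop_sym f g : L2 f -> L2 g -> ip (kop f) g = ip f (kop g).
Proof.
move=> lf lg.
(* Extension by zero moves the integrals to the whole plane, where Fubini applies. *)
pose wI := (fun p : R * R => w p.1 p.2) \_ (I01 `*` I01).
pose fI := f \_ I01; pose gI := g \_ I01.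
pose k (p : R * R) := wI p * (fI p.2 * gI p.1).
have mfI : measurable_fun setT fI.
  by apply/(measurable_restrictT f (@measurable_I01 R)); exact: lf.1.
have mgI : measurable_fun setT gI.
  by apply/(measurable_restrictT g (@measurable_I01 R)); exact: lg.1.
have mk : measurable_fun setT k.
  apply: measurable_funM.
    have mI2 : measurable (I01 `*` I01) by apply: measurableX; exact: measurable_I01.
    by apply/(measurable_restrictT _ mI2); exact: gw.1.
  by apply: measurable_funM; apply: measurableT_comp.
have mkE : measurable_fun setT (EFin \o k) by exact/measurable_EFinP.
have kE x y : k (x, y) = if (x \in I01) && (y \in I01) then w x y * (f y * g x) else 0.
  rewrite /k /wI /fI /gI !patchE /=.
  have -> : ((x, y) \in I01 `*` I01) = (x \in I01) && (y \in I01).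
    apply/idP/andP => [/set_mem[/= xI yI]|[/set_mem xI /set_mem yI]].
      by split; exact: mem_set.
    exact: mem_set.
  by case: (x \in I01); case: (y \in I01) => //=; rewrite mul0r.
have itfg a b : L2 a -> L2 b -> forall x, I01 x ->
    (\int[leb]_(y in I01) (w x y * (a y * b x))%:E = (kop a x * b x)%:E)%E.
  move=> la lb x xI; have itk := itg_kernel xI (L2_itg la).
  transitivity (\int[leb]_(y in I01) (b x * (w x y * a y))%:E)%E.
    by apply: eq_integral => y _; congr EFin; ring.
  have fin : (\int[leb]_(y in I01) (b x * (w x y * a y))%:E \is a fin_num)%E.
    by apply: integrable_fin_num => //; exact: (itgZ (b x) itk).
  by rewrite -(fineK fin) [kop a x * b x]mulrC /kop -IntZ.
have ipE a b : L2 a -> L2 b ->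
    (\int[leb]_(x in I01) (kop a x * b x)%:E = (ip (kop a) b)%:E)%E.
  move=> la lb; have itab : itg (fun x => kop a x * b x).
    by apply: L2_itgM => //; exact/kop_L2/L2_itg.
  by rewrite /ip /Rintegral fineK//; apply: integrable_fin_num.
have Fx : (\int[leb]_x \int[leb]_y (k (x, y))%:E = (ip (kop f) g)%:E)%E.
  rewrite -ipE// [RHS]integral_mkcond; apply: eq_integral => x _.
  rewrite patchE; case: ifPn => [/set_mem xI|xI].
    rewrite -itfg// [RHS]integral_mkcond; apply: eq_integral => y _.
    by rewrite patchE kE (mem_set xI) /=; case: ifP.
  by apply: integral0_eq => y _; rewrite kE (negbTE xI).
have Fy : (\int[leb]_y \int[leb]_x (k (x, y))%:E = (ip (kop g) f)%:E)%E.
  rewrite -ipE// [RHS]integral_mkcond; apply: eq_integral => y _.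
  rewrite patchE; case: ifPn => [/set_mem yI|yI].
    rewrite -itfg// [RHS]integral_mkcond; apply: eq_integral => x _.
    rewrite patchE kE (mem_set yI) andbT; case: ifP => // /set_mem xI.
    by rewrite (wsym xI yI) [f y * g x]mulrC.
  by apply: integral0_eq => x _; rewrite kE (negbTE yI) andbF.
rewrite [RHS]ipC; apply: EFin_inj; rewrite -Fx -Fy.
apply: (@Fubini _ _ _ _ _ leb leb (EFin \o k)).
apply/integrable12ltyP => //.
(* As [w] is at most 1, a product of integrable functions dominates [k], which gives its
   integrability on the plane. *)
have kle x y : `|k (x, y)| <= `|fI y| * `|gI x|.
  rewrite /k /= normrM normrM ler_piMl ?mulr_ge0// /wI patchE.
  by case: ifPn => [/set_mem[/= xI yI]|_]; rewrite ?normr0// graphon_norm.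
have itfI : (\int[leb]_y (`|fI y|)%:E = (Int (fun y => `|f y|))%:E)%E.
  have fin : (\int[leb]_(y in I01) (`|f y|)%:E \is a fin_num)%E.
    by have itf := itg_norm (L2_itg lf); apply: integrable_fin_num itf.
  rewrite /Int /Rintegral (fineK fin).
  rewrite [RHS]integral_mkcond; apply: eq_integral => y _.
  by rewrite /fI !patchE; case: ifP; rewrite ?normr0.
have itgI : (\int[leb]_y (`|gI y|)%:E = (Int (fun y => `|g y|))%:E)%E.
  have fin : (\int[leb]_(y in I01) (`|g y|)%:E \is a fin_num)%E.
    by have itg := itg_norm (L2_itg lg); apply: integrable_fin_num itg.
  rewrite /Int /Rintegral (fineK fin).
  rewrite [RHS]integral_mkcond; apply: eq_integral => y _.
  by rewrite /gI !patchE; case: ifP; rewrite ?normr0.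
apply: (@le_lt_trans _ _ (\int[leb]_x ((Int (fun y => `|f y|))%:E * (`|gI x|)%:E))%E).
  apply: ge0_le_integral => //.
  - by move=> x _; apply: integral_ge0.
  - have mak : measurable_fun setT (abse \o (EFin \o k)) by exact: measurableT_comp.
    exact: (@measurable_fun_fubini_tonelli_F _ _ _ _ _ leb (abse \o (EFin \o k))
      mak (fun=> abse_ge0 _)).
  - apply: measurable_funeM; apply/measurable_EFinP.
    exact: measurableT_comp.
  - move=> x _; rewrite -itfI -ge0_integralZr//; last first.
      by apply/measurable_EFinP; exact: measurableT_comp.
    apply: ge0_le_integral => //.
    + apply: measurableT_comp => //.
      by apply/measurable_EFinP; exact: measurableT_comp mk (measurable_pair1 x).
    + apply/measurable_EFinP; apply: measurable_funM => //.
      exact: measurableT_comp.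
    + by move=> y _; rewrite /= lee_fin kle.
rewrite ge0_integralZl//.
- by rewrite itgI -EFinM ltry.
- by apply/measurable_EFinP; exact: measurableT_comp.
- by rewrite lee_fin Int_norm_ge0.
Qed.
End Operator.

(** * Arzela-Ascoli along an ultrafilter, which replaces the extraction of subsequences *)

Section EquiLipschitz.
Variable R : realType.
Notation I01 := (@I01 R).
Variables (U : set_system nat) (UU : UltraFilter U).

(** The image of [U] under [a] is an ultrafilter on the compact segment [[- B, B]]. *)
Lemma ultra_bounded_cvg (a : nat -> R) B : (forall n, `|a n| <= B) ->
  exists l : R, a @ U --> l.
Proof.
move=> aB.
have aU : UltraFilter (a @ U).
  split=> [|G GG aG]; first exact: fmap_proper_filter.
  apply/seteqP; split => // A GA.
  have [//|nA] := in_ultra_setVsetC (a @^-1` A) UU.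
  have [x []] := filter_ex (filterI GA (aG (~` A) nA)).
  by [].
have := @segment_compact R (- B) B; rewrite compact_ultra.
move=> /(_ (a @ U) aU)[].
  have : U (a @^-1` `[- B, B]) by apply: filterE => n; rewrite /= in_itv /= -ler_norml.
  by [].
by move=> l [_ al]; exists l.
Qed.

(** Pointwise limits along [U] exist and inherit the Lipschitz constant; closeness on a finite grid
    then spreads to the whole interval. *)
Lemma equilipschitz_ultra (h_ : nat -> R -> R) B C :
  (forall n x, I01 x -> `|h_ n x| <= B) -> (forall n, lipschitzI C (h_ n)) ->
  exists h, lipschitzI C h /\ forall e, 0 < e ->
    U [set n | forall x, I01 x -> `|h_ n x - h x| <= e].
Proof.
move=> hB hC; have FU : Filter U by exact: filter_filter.
have /choice[h hh] : forall x, exists l : R, I01 x -> h_ ^~ x @ U --> l.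
  move=> x; have [xI|xI] := pselect (I01 x); last by exists 0.
  have [|l ?] := @ultra_bounded_cvg (h_ ^~ x) B; first by move=> n; exact: hB.
  by exists l.
have hlim x e : I01 x -> 0 < e -> U [set n | `|h x - h_ n x| < e].
  by move=> xI e0; have /cvgrPdist_lt/(_ _ e0) := hh x xI.
have lh : lipschitzI C h.
  move=> x y xI yI; apply/ler_addgt0Pr => e e0.
  have e2 : 0 < e / 2 by lra.
  have [n [hx hy]] := filter_ex (filterI (hlim x _ xI e2) (hlim y _ yI e2)).
  have -> : h x - h y = (h x - h_ n x) + ((h_ n x - h_ n y) - (h y - h_ n y)) by ring.
  apply: le_trans (ler_normD _ _) _.
  have := ler_normB (h_ n x - h_ n y) (h y - h_ n y).
  have := hC n x y xI yI; move: hx hy => /=; lra.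
exists h; split => // e e0.
have C0 := lipschitzI_ge0 lh.
(* Between neighbouring grid points [h_ n] and [h] vary by less than [e / 4]. *)
pose N := (Num.truncn (4 * C / e)).+1.
have N0 : 0 < N%:R :> R by rewrite ltr0n.
have CN : C / N%:R < e / 4.
  rewrite ltr_pdivrMr//.
  have : 4 * C / e < N%:R by rewrite real_truncnS_gt// num_real.
  by rewrite ltr_pdivrMr//; lra.
have e4 : 0 < e / 4 by lra.
(* The index [N] must be included: [truncn (x * N)] reaches it at [x = 1]. *)
have gI (k : 'I_N.+1) : I01 (k%:R / N%:R).
  apply/I01E; rewrite divr_ge0//= ler_pdivrMr// mul1r ler_nat.
  by rewrite -ltnS.
have hgrid := filter_forall FU (fun k : 'I_N.+1 => hlim _ _ (gI k) e4).
apply: filterS hgrid => n hn x xI.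
move/I01E: (xI) => /andP[x0 x1].
have xN0 : 0 <= x * N%:R by rewrite mulr_ge0// ltW.
have /andP[t1 t2] := truncn_itv xN0.
have kN : (Num.truncn (x * N%:R) < N.+1)%N.
  rewrite ltnS -(ler_nat R); apply: le_trans t1 _.
  by rewrite ler_piMl// ltW.
have := hn (Ordinal kN); have := gI (Ordinal kN) => /=.
set y := _ / _ => yI hy.
have xy : `|x - y| <= N%:R^-1.
  have yN : y * N%:R = (Num.truncn (x * N%:R))%:R by rewrite /y mulfVK// gt_eqF.
  move: t2; rewrite -natr1 => t2.
  rewrite ler_norml; apply/andP; split; rewrite -(ler_pM2r N0) mulrBl yN ?mulNr.
    by rewrite mulVf ?gt_eqF//; lra.
  by rewrite mulVf ?gt_eqF//; lra.
have Cxy : C * `|x - y| <= C / N%:R by rewrite ler_wpM2l.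
have -> : h_ n x - h x = (h_ n x - h_ n y) - ((h x - h y) + (h y - h_ n y)) by ring.
apply: le_trans (ler_normB _ _) _.
have := ler_normD (h x - h y) (h y - h_ n y).
have := hC n x y xI yI; have := lh x y xI yI; lra.
Qed.

End EquiLipschitz.

(** * Compactness of approximate solutions of [L f - c f = g] for [c] below the degrees *)

Section Compactness.
Variable R : realType.
Notation leb := (@lebesgue_measure R).
Notation I01 := (@I01 R).
Implicit Types f g h : R -> R.
Variable w : R -> R -> R.
Hypothesis gw : graphon w.
Variable K : R.
Hypothesis lw : forall x y x' y', I01 x -> I01 y -> I01 x' -> I01 y' ->
    `|w x y - w x' y'| <= K * (`|x - x'| + `|y - y'|).
Notation kop := (kop w).
Notation d := (degree w).

Lemma lap_sym f g : L2 f -> L2 g -> ip (lap w f) g = ip f (lap w g).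
Proof.
move=> lf lg; rewrite [RHS]ipC !(lap_ip gw lw)// (kop_sym gw lw)// [ip f _]ipC.
by congr (_ - _); apply: eq_Int => x _; ring.
Qed.

Lemma lap_cst a x : I01 x -> lap w (fun=> a) x = 0.
Proof.
move=> xI; rewrite -[RHS](@Int_cst R); apply: eq_Int => y _.
by rewrite subrr mulr0.
Qed.

(** By symmetry, [L] can be moved to the constant 1, which it kills. *)
Lemma Int_lap f : L2 f -> Int (lap w f) = 0.
Proof.
move=> lf; rewrite -ip1E lap_sym//; last exact: L2_cst.
rewrite ipC -[RHS](@Int_cst R); apply: eq_Int => x xI.
by rewrite lap_cst// mul0r.
Qed.

Variables c delta : R.
Hypothesis delta0 : 0 < delta.
Hypothesis cd : forall x, I01 x -> c + delta <= d x.

Lemma degree_sub_gt0 x : I01 x -> 0 < d x - c.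
Proof. by move=> /cd; have := delta0; lra. Qed.

Lemma inv_degree_lip : lipschitzI (K / delta ^+ 2) (fun x => (d x - c)^-1).
Proof.
move=> x y xI yI.
have [dx dy] := (degree_sub_gt0 xI, degree_sub_gt0 yI).
have -> : (d x - c)^-1 - (d y - c)^-1 = (d y - d x) / ((d x - c) * (d y - c)).
  by field; rewrite !gt_eqF.
rewrite normrM mulrAC; apply: ler_pM => //.
  by rewrite distrC (degree_lip gw lw).
rewrite ger0_norm; last by rewrite invr_ge0 ltW// mulr_gt0.
rewrite lef_pV2 ?posrE ?mulr_gt0 ?exprn_gt0// expr2.
have := delta0; have := cd xI; have := cd yI => *; apply: ler_pM; lra.
Qed.

Lemma inv_degree_le x : I01 x -> `|(d x - c)^-1| <= delta^-1.
Proof.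
move=> xI; have dx := degree_sub_gt0 xI.
rewrite ger0_norm; last by rewrite invr_ge0 ltW.
by rewrite lef_pV2 ?posrE//; have := cd xI; lra.
Qed.

Lemma inv_degreeM_L2 f : L2 f -> L2 (fun x => (d x - c)^-1 * f x).
Proof.
apply: (@L2_mulb _ delta^-1); last exact: inv_degree_le.
exact: lipschitzI_measurable inv_degree_lip.
Qed.

(** With residual [r n], the equation reads [(d - c) f_ n = W (f_ n) + g + r n]. The terms
    [W (f_ n)] converge uniformly along an ultrafilter and [d - c] is bounded below, so [f_ n]
    itself converges in norm. *)
Lemma lap_compact (f_ : nat -> R -> R) g M D :
  (forall n, L2 (f_ n)) -> (forall n, ip (f_ n) (f_ n) <= M) -> L2 g ->
  (forall n, ip (fun x => lap w (f_ n) x - c * f_ n x - g x)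
                (fun x => lap w (f_ n) x - c * f_ n x - g x) <= D / n.+1%:R) ->
  exists f, [/\ L2 f, forall x, I01 x -> lap w f x - c * f x = g x &
    forall e, 0 < e -> exists n,
      ip (fun x => f_ n x - f x) (fun x => f_ n x - f x) < e].
Proof.
move=> lf fM lg rD.
have [U [UU UN]] : exists U, UltraFilter U /\ \oo `<=` U by exact: ultraFilterLemma.
have FU : Filter U by exact: filter_filter.
(* From [2 * t <= 1 + t ^+ 2], with [t] the L1 norm of [f_ n]. *)
have ifM n : Int (fun y => `|f_ n y|) <= (1 + M) / 2.
  have := Int_norm_sq_le (lf n); have := fM n.
  have := sqr_ge0 (Int (fun y => `|f_ n y|) - 1); rewrite sqrrB; lra.
have K0 : 0 <= K := lipschitzI_ge0 (degree_lip gw lw).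
have [h [lh hU]] : exists h, lipschitzI (K * ((1 + M) / 2)) h /\ forall e, 0 < e ->
    U [set n | forall x, I01 x -> `|kop (f_ n) x - h x| <= e].
  apply: (@equilipschitz_ultra _ U UU (fun n => kop (f_ n)) ((1 + M) / 2)).
  - move=> n x xI; apply: le_trans (ifM n); apply: (kop_bound gw lw) => //.
    exact: L2_itg.
  - move=> n x y xI yI; apply: le_trans (kop_lip gw lw (L2_itg (lf n)) xI yI) _.
    by rewrite ler_wpM2r// ler_wpM2l.
have lh2 := lipschitzI_L2 lh.
(* The limit forced by the equation, with [h] in place of [W f]; that [h] is [W f] is proved last,
   as [hk]. *)
pose f x := (d x - c)^-1 * (1 * h x + 1 * g x).
have lf2 : L2 f by apply: inv_degreeM_L2; exact: L2_lin.
pose r n x := lap w (f_ n) x - c * f_ n x - g x.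
have lr n : L2 (r n).
  apply: L2B => //; apply: L2B; first exact: (lap_L2 gw lw).
  exact: L2Z.
pose k n x := kop (f_ n) x - h x.
have lk n : L2 (k n) by apply: L2B => //; apply: (kop_L2 gw lw); exact: L2_itg.
have fE n x : I01 x -> f_ n x - f x = (d x - c)^-1 * (r n x + k n x).
  move=> xI; have dx := degree_sub_gt0 xI.
  rewrite /r /k (lapE gw lw)//; last exact: L2_itg.
  by rewrite /f; field; rewrite gt_eqF.
have fle n : ip (fun x => f_ n x - f x) (fun x => f_ n x - f x) <=
    delta^-1 ^+ 2 * 2 * (ip (r n) (r n) + ip (k n) (k n)).
  have [irr ikk] := (L2_itgM (lr n) (lr n), L2_itgM (lk n) (lk n)).
  rewrite -IntD// -IntZ; last exact: itgD.
  apply: Int_le; [by apply: L2_itgM; exact: L2B|exact/itgZ/itgD|].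
  move=> x xI; rewrite fE//; set q := (d x - c)^-1.
  have -> : q * (r n x + k n x) * (q * (r n x + k n x)) = q ^+ 2 * (r n x + k n x) ^+ 2.
    by ring.
  rewrite -[leRHS]mulrA; apply: ler_pM; rewrite ?sqr_ge0//.
    by rewrite -(real_normK (num_real q)) lerXn2r ?nnegrE ?invr_ge0// ?inv_degree_le// ltW.
  by move: (r n x) (k n x) => a b; have := sqr_ge0 (a - b); nra.
have fU e : 0 < e -> U [set n | ip (fun x => f_ n x - f x) (fun x => f_ n x - f x) < e].
  (* With both terms of [fle] at most [b], its right-hand side is at most [e / 2]. *)
  move=> e0; pose b := e / (8 * delta^-1 ^+ 2).
  have i2 : 0 < delta^-1 ^+ 2 by rewrite exprn_gt0// invr_gt0.
  have b0 : 0 < b by rewrite divr_gt0// mulr_gt0.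
  have rU : U [set n | ip (r n) (r n) <= b].
    apply: UN; exists (Num.truncn (`|D| / b)).+1 => // n /= nN.
    apply: le_trans (rD n) _; rewrite ler_pdivrMr// mulrC -ler_pdivrMr//.
    apply: (@le_trans _ _ (`|D| / b)); first by rewrite ler_pM2r ?invr_gt0// ler_norm.
    apply/ltW/(@lt_le_trans _ _ (Num.truncn (`|D| / b)).+1%:R).
      by rewrite real_truncnS_gt// num_real.
    by rewrite ler_nat (leq_trans nN)// leqnSn.
  (* The cap 1 ensures that the square of [k n x] is at most its absolute value, hence at most
     [b]. *)
  have b1 : 0 < Num.min b 1 by rewrite lt_min b0 ltr01.
  apply: filterS (filterI rU (hU _ b1)) => n [rn kn].
  apply: le_lt_trans (fle n) _.
  have kb : ip (k n) (k n) <= b.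
    rewrite -[leRHS](@Int_cst R); apply: Int_le; [exact: L2_itgM|exact: itg_cst|].
    move=> x xI; have := kn x xI; rewrite -/(k n x) le_min => /andP[kb k1].
    rewrite -expr2 -(real_normK (num_real (k n x))).
    by rewrite (le_trans _ kb)// expr2 ler_piMl.
  apply: (@le_lt_trans _ _ (delta^-1 ^+ 2 * 2 * (b + b))).
    by apply: ler_wpM2l; [rewrite mulr_ge0// ltW|exact: lerD].
  have -> : delta^-1 ^+ 2 * 2 * (b + b) = e / 2.
    by rewrite /b; field; rewrite gt_eqF.
  lra.
(* Norm convergence of [f_ n] implies uniform convergence of [W (f_ n)] to [W f], so both limits
   agree. *)
have hk x : I01 x -> h x = kop f x.
  move=> xI; apply/eqP; rewrite -subr_eq0 -normr_le0; apply/ler_addgt0Pr => e e0.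
  have e2 : 0 < e / 2 by lra.
  have e4 : 0 < (e / 2) ^+ 2 by rewrite exprn_gt0.
  have [n [fn kn]] := filter_ex (filterI (fU _ e4) (hU _ e2)).
  have kB : kop (fun y => f_ n y - f y) x = kop (f_ n) x - kop f x.
    transitivity (1 * kop (f_ n) x + (-1) * kop f x); last by ring.
    rewrite -(kop_lin gw lw)//; [|exact: L2_itg..].
    by apply: eq_kop => y _; ring.
  have lB : L2 (fun y => f_ n y - f y) by exact: L2B.
  have := kop_bound gw lw xI (L2_itg lB); rewrite kB.
  have := le_lt_trans (Int_norm_sq_le lB) fn.
  rewrite ltr_pXn2r ?nnegrE ?Int_norm_ge0 ?(ltW e2)// => If /le_lt_trans/(_ If) kf.
  have -> : h x - kop f x = (kop (f_ n) x - kop f x) - (kop (f_ n) x - h x) by ring.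
  have := ler_normB (kop (f_ n) x - kop f x) (kop (f_ n) x - h x).
  have := kn x xI; lra.
exists f; split => //.
- move=> x xI; have dx := degree_sub_gt0 xI.
  rewrite (lapE gw lw) -?hk//; last exact: L2_itg.
  by rewrite /f; field; rewrite gt_eqF.
- by move=> e /fU /filter_ex.
Qed.

End Compactness.

(** * Minimizing the energy on the orthogonal of a family of eigenfunctions *)

Section Energy.
Variable R : realType.
Notation leb := (@lebesgue_measure R).
Notation I01 := (@I01 R).
Implicit Types f g h : R -> R.

(** [H1] and [H2] are the usual squares, which settle the case of a nonzero norm; when both norms
    vanish, [H3] and [H4] force [ip f g] to be 0. *)
Lemma ip_CauchySchwarz f g : L2 f -> L2 g -> ip f g ^+ 2 <= ip f f * ip g g.
Proof.
move=> lf lg.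
have H1 := ip_ge0 (fun x => ip g g * f x + (- ip f g) * g x).
have H2 := ip_ge0 (fun x => (- ip f g) * f x + ip f f * g x).
have H3 := ip_ge0 (fun x => 1 * f x + 1 * g x).
have H4 := ip_ge0 (fun x => 1 * f x + (-1) * g x).
move: H1 H2 H3 H4; rewrite !ip_sq_lin//.
have := ip_ge0 f; have := ip_ge0 g.
move: (ip f f) (ip g g) (ip f g) => a b s b0 a0 H1 H2 H3 H4.
have [b1|b1] := ltP 0 b.
  have : 0 <= b * (a * b - s ^+ 2) by nra.
  by rewrite pmulr_rge0// subr_ge0.
have [a1|a1] := ltP 0 a.
  have : 0 <= a * (a * b - s ^+ 2) by nra.
  by rewrite pmulr_rge0// subr_ge0.
have -> : s = 0 by lra.
by rewrite expr0n /= mulr_ge0.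
Qed.

Lemma ip_limit0 f h : L2 f -> L2 h ->
  (forall e, 0 < e -> exists f', [/\ L2 f', ip f' h = 0 &
    ip (fun x => f' x - f x) (fun x => f' x - f x) < e]) -> ip f h = 0.
Proof.
move=> lf lh H; apply/eqP; rewrite -sqrf_eq0 eq_le sqr_ge0 andbT.
apply/ler_addgt0Pr => e e0; have hh0 := ip_ge0 h.
have e1 : 0 < e / (ip h h + 1) by rewrite divr_gt0//; lra.
have [f' [lf' f'h fe]] := H _ e1.
have lB := L2B lf' lf.
have : ip (fun x => f' x - f x) h = - ip f h by rewrite ipBl// f'h sub0r.
have := ip_CauchySchwarz lB lh => /[swap] ->; rewrite sqrrN add0r => /le_trans; apply.
apply: (@le_trans _ _ (e / (ip h h + 1) * (ip h h + 1))).
  by apply: ler_pM => //; [exact: ip_ge0|exact: ltW|lra].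
by rewrite divfK// gt_eqF//; lra.
Qed.

Variable w : R -> R -> R.
Hypothesis gw : graphon w.
Variable K : R.
Hypothesis lw : forall x y x' y', I01 x -> I01 y -> I01 x' -> I01 y' ->
    `|w x y - w x' y'| <= K * (`|x - x'| + `|y - y'|).
Notation d := (degree w).

Definition orth (S : set (R -> R)) f := L2 f /\ forall h, S h -> ip f h = 0.
Definition eigenfamily (S : set (R -> R)) := forall h, S h -> exists a, eigfun w a h.
(** Half the gradient of [energy] at [f]. *)
Definition residual c g f x := lap w f x - c * f x - g x.
Definition energy c g f := ip (lap w f) f - c * ip f f - 2 * ip g f.

Lemma orth_lin S a b f g : eigenfamily S -> orth S f -> orth S g ->
  orth S (fun x => a * f x + b * g x).
Proof.
move=> eS [lf Sf] [lg Sg]; split; first exact: L2_lin.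
move=> h Sh; have [al [lh _]] := eS h Sh.
by rewrite ip_lin// Sf// Sg// !mulr0 addr0.
Qed.

(** By symmetry [L] moves to the eigenfunction, where it is a scalar. *)
Lemma orth_lap S f : eigenfamily S -> orth S f -> orth S (lap w f).
Proof.
move=> eS [lf Sf]; split; first exact: (lap_L2 gw lw).
move=> h Sh; have [a [lh ah]] := eS h Sh.
rewrite (lap_sym gw lw)// ipC.
have llh := lap_L2 gw lw lh.
rewrite (ip_ae (L2_measurable llh) (L2_measurable (L2Z a lh)) (L2_measurable lf) ah).
by rewrite ipZl// ipC Sf// mulr0.
Qed.

Lemma residualE c g f x :
  residual c g f x = 1 * lap w f x + 1 * ((- c) * f x + (-1) * g x).
Proof. by rewrite /residual; ring. Qed.

Lemma orth_ext S f g : (forall x, f x = g x) -> orth S f -> orth S g.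
Proof. by move=> /funext ->. Qed.

Lemma orth_residual S c g f : eigenfamily S -> orth S f -> orth S g ->
  orth S (residual c g f).
Proof.
move=> eS Sf Sg.
have := orth_lin 1 1 eS (orth_lap eS Sf) (orth_lin (- c) (-1) eS Sf Sg).
by apply: orth_ext => x; rewrite residualE.
Qed.

Lemma residual_ip c g f h : L2 f -> L2 g -> L2 h ->
  ip (residual c g f) h = ip (lap w f) h - c * ip f h - ip g h.
Proof.
move=> lf lg lh.
have -> : residual c g f = fun x => 1 * lap w f x + 1 * ((- c) * f x + (-1) * g x).
  by apply/funext => x; exact: residualE.
rewrite ip_lin//; [|exact: (lap_L2 gw lw)|exact: L2_lin].
by rewrite ip_lin//; ring.
Qed.

Lemma lap_quad a b f g : L2 f -> L2 g ->
  ip (lap w (fun x => a * f x + b * g x)) (fun x => a * f x + b * g x) =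
  a ^+ 2 * ip (lap w f) f + 2 * a * b * ip (lap w f) g + b ^+ 2 * ip (lap w g) g.
Proof.
move=> lf lg; have [llf llg] := (lap_L2 gw lw lf, lap_L2 gw lw lg).
have lfg := L2_lin a b lf lg.
rewrite (@eq_ip _ _ (fun x => a * lap w f x + b * lap w g x)); last first.
  by move=> x xI; rewrite (lap_lin gw lw)//; exact: L2_itg.
rewrite ip_lin// ![ip _ (fun x => _ + _)]ipC !ip_lin//.
rewrite (ipC f (lap w g)) (lap_sym gw lw lg lf) (ipC g (lap w f)) !(ipC f) (ipC g (lap w g)).
ring.
Qed.

(** A gradient step: passing from [f] to [f - M^-1 * r], where [M = 2 + |c|] bounds the form of
    [L - c], lowers the energy by at least [M^-1 * ip r r]. An almost minimizer therefore has a
    small residual. *)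
Lemma energy_step S c g j e f : eigenfamily S -> orth S g ->
  (forall f, orth S f -> j <= energy c g f) -> orth S f ->
  energy c g f <= j + e ->
  ip (residual c g f) (residual c g f) <= (2 + `|c|) * e.
Proof.
move=> eS Sg jE Sf fE; set r := residual c g f.
have Sr : orth S r by exact: orth_residual.
have [lf lg lr] : [/\ L2 f, L2 g & L2 r] by split; [case: Sf|case: Sg|case: Sr].
set M := 2 + `|c|; have M0 : 0 < M by rewrite /M; have := normr_ge0 c; lra.
have := jE _ (orth_lin 1 (- M^-1) eS Sf Sr).
rewrite /energy lap_quad// ip_sq_lin// [ip g (fun x => _ + _)]ipC ip_lin//.
rewrite (ipC f g) (ipC r g).
have := residual_ip c lf lg lr; rewrite -/r => rr.
have rb : ip (lap w r) r - c * ip r r <= M * ip r r.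
  have := lap_ip_le gw lw lr; have := ip_ge0 r; rewrite /M => r0.
  rewrite ler_norml => /andP[_ q2].
  have : - c * ip r r <= `|c| * ip r r by rewrite ler_wpM2r// -normrN ler_norm.
  lra.
move=> jle.
have : 2 * M^-1 * ip r r - M^-1 ^+ 2 * (ip (lap w r) r - c * ip r r) <= e.
  move: fE; rewrite /energy {1}rr; lra.
have : M^-1 ^+ 2 * (ip (lap w r) r - c * ip r r) <= M^-1 * ip r r.
  apply: le_trans (ler_wpM2l _ rb) _; first by rewrite exprn_ge0// invr_ge0 ltW.
  by rewrite expr2 -mulrA mulKf// gt_eqF.
move=> h1 h2; have : M^-1 * ip r r <= e by lra.
by rewrite ler_pdivrMl.
Qed.

Variables c delta : R.
Hypothesis delta0 : 0 < delta.
Hypothesis cd : forall x, I01 x -> c + delta <= d x.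

(** Residuals of a minimizing sequence tend to 0 by [energy_step], so [lap_compact] applies. The
    last clause is kept so that norms can be passed to the limit. *)
Lemma energy_attained S g j M (f_ : nat -> R -> R) : eigenfamily S -> orth S g ->
  (forall f, orth S f -> j <= energy c g f) ->
  (forall n, [/\ orth S (f_ n), ip (f_ n) (f_ n) <= M &
    energy c g (f_ n) <= j + n.+1%:R^-1]) ->
  exists f, [/\ orth S f, forall x, I01 x -> lap w f x - c * f x = g x &
    forall e, 0 < e -> exists n,
      ip (fun x => f_ n x - f x) (fun x => f_ n x - f x) < e].
Proof.
move=> eS Sg jE H.
have lf n : L2 (f_ n) by case: (H n) => -[].
have fM n : ip (f_ n) (f_ n) <= M by case: (H n).
have [//||f [lf0 ef fe]] := @lap_compact _ w gw K lw c delta delta0 cd f_ g M (2 + `|c|) lf fM.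
- by case: Sg.
- by move=> n; case: (H n) => Sf _ Ef; exact: (energy_step eS Sg jE Sf Ef).
exists f; split => //; split => // h Sh; have [a [lh _]] := eS h Sh.
apply: ip_limit0 => // e /fe[n fn]; exists (f_ n); split => //.
by case: (H n) => -[_ Sf] _ _; exact: Sf.
Qed.

End Energy.

(** * Total variation of a Lipschitz function *)

Section Variation.
Variable R : realType.
Notation I01 := (@I01 R).
Implicit Types f H : R -> R.

Definition dominates f H a b :=
  forall s t, a <= s -> s <= t -> t <= b -> `|f t - f s| <= H t - H s.

(* The total variation of [f] on [0, x], as the least increment of a dominating
   function: this universal property is all that is used, so no partitions. *)
Definition variation_on f x :=
  inf [set H x - H 0 | H in [set H | dominates f H 0 x]].

Variables (f : R -> R) (C : R).
Hypothesis lf : lipschitzI C f.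

Let dom_lin a b : 0 <= a -> b <= 1 -> dominates f (fun x => C * x) a b.
Proof.
move=> a0 b1 s t as_ st tb.
have sI : I01 s by apply/I01E; lra.
have tI : I01 t by apply/I01E; lra.
apply: le_trans (lf tI sI) _; rewrite -mulrBr ger0_norm ?subr_ge0//.
Qed.

Let var_lb x : 0 <= x ->
  has_lbound [set H x - H 0 | H in [set H | dominates f H 0 x]].
Proof.
move=> x0; exists 0 => _ [H domH <-].
by apply: le_trans (normr_ge0 _) (domH 0 x _ _ _).
Qed.

Let var_n0 x : x <= 1 ->
  [set H x - H 0 | H in [set H | dominates f H 0 x]] !=set0.
Proof. by move=> x1; exists (C * x - C * 0); exists (fun x => C * x) => //; exact: dom_lin. Qed.

(** A function dominating [f] on [[0, t]] also does so on [[0, s]], and its increment from [s] to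
    [t] is at least that of [f]. *)
Lemma variation_ge s t : 0 <= s -> s <= t -> t <= 1 ->
  `|f t - f s| <= variation_on f t - variation_on f s.
Proof.
move=> s0 st t1; rewrite lerBrDr; apply: lb_le_inf; first exact: var_n0.
move=> _ [H domH <-].
have t0 := le_trans s0 st.
have : variation_on f s <= H s - H 0.
  apply: ge_inf; first exact: var_lb.
  exists H => // a b a0 ab bs; apply: domH => //; exact: le_trans bs st.
have := domH s t s0 st (lexx _); lra.
Qed.

Lemma variation_le H a b : 0 <= a -> a <= b -> b <= 1 -> dominates f H a b ->
  variation_on f b - variation_on f a <= H b - H a.
Proof.
move=> a0 ab b1 domH.
suff : variation_on f b - (H b - H a) <= variation_on f a by lra.
apply: lb_le_inf; first by apply: var_n0; lra.
move=> _ [H0 domH0 <-].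
(* Gluing a competitor on [[0, a]] with [H] on [[a, b]] gives a competitor on [[0, b]]. *)
pose H1 x := if x <= a then H0 x else H0 a + (H x - H a).
suff : variation_on f b <= H1 b - H1 0.
  rewrite /H1 a0; case: ifPn => [ba|_]; last by lra.
  by have -> : b = a by [apply: le_anti; rewrite ba ab]; rewrite subrr subr0.
have b0 := le_trans a0 ab.
apply: ge_inf; first exact: var_lb.
exists H1 => // s t s0 st tb; rewrite /H1.
case: ifPn => ta; case: ifPn => sa.
- exact: domH0.
- by exfalso; move: sa; rewrite (le_trans st ta).
- move: ta; rewrite -ltNge => /ltW ta.
  have := domH0 s a s0 sa (lexx _); have := domH a t (lexx _) ta tb.
  have := ler_normD (f t - f a) (f a - f s).
  have -> : f t - f a + (f a - f s) = f t - f s by ring.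
  lra.
- move: sa; rewrite -ltNge => /ltW sa; have := domH s t sa st tb; lra.
Qed.

Lemma variation_lip : lipschitzI C (variation_on f).
Proof.
have key x y : I01 x -> I01 y -> x <= y ->
    `|variation_on f x - variation_on f y| <= C * `|x - y|.
  move=> /I01E/andP[x0 x1] /I01E/andP[y0 y1] xy.
  have h1 := variation_ge x0 xy y1.
  have h2 := variation_le x0 xy y1 (dom_lin x0 y1).
  rewrite distrC [`|x - y|]distrC !ger0_norm ?subr_ge0//.
    by rewrite mulrBr.
  by rewrite -subr_ge0 (le_trans _ h1).
move=> x y xI yI; have [xy|/ltW yx] := leP x y; first exact: key.
by rewrite distrC [`|x - y|]distrC; exact: key.
Qed.

End Variation.

(** * Monotonicity from a quadratic bound on increments *)

Section QuadraticMonotone.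
Variable R : realType.

(** Each bisection of the interval halves the constant, so the bound tends to 0. *)
Lemma nonincreasing_of_quadratic (v : R -> R) C a b :
  (forall x y, a <= x -> x <= y -> y <= b -> v y - v x <= C * (y - x) ^+ 2) ->
  a <= b -> v b <= v a.
Proof.
move=> H ab.
have Hn n : forall x y, a <= x -> x <= y -> y <= b ->
    v y - v x <= C * (y - x) ^+ 2 / (2 ^+ n).
  elim: n => [|n IH] x y ax xy yb; first by rewrite expr0 divr1 H.
  pose z := (x + y) / 2.
  have h1 : v z - v x <= C * (z - x) ^+ 2 / 2 ^+ n by apply: IH; rewrite /z; lra.
  have h2 : v y - v z <= C * (y - z) ^+ 2 / 2 ^+ n by apply: IH; rewrite /z; lra.
  have -> : C * (y - x) ^+ 2 / 2 ^+ n.+1 =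
     C * (z - x) ^+ 2 / 2 ^+ n + C * (y - z) ^+ 2 / 2 ^+ n.
    by rewrite /z [2 ^+ n.+1]exprS invfM; move: (2 ^+ n)^-1 => q; field.
  lra.
rewrite leNgt; apply/negP => vab; pose e := v b - v a.
have e0 : 0 < e by rewrite /e; lra.
pose D := C * (b - a) ^+ 2.
pose n := (Num.truncn (`|D| / e)).+1.
have nD : `|D| / e < n%:R by rewrite real_truncnS_gt// num_real.
have := Hn n a b (lexx _) ab (lexx _); rewrite -/D -/e ler_pdivlMr ?exprn_gt0//.
apply/negP; rewrite -ltNge.
apply: (@le_lt_trans _ _ `|D|); first exact: ler_norm.
move: nD; rewrite ltr_pdivrMr// => /lt_le_trans; apply.
rewrite mulrC ler_pM2l// -natrX ler_nat; apply/ltnW; exact: ltn_expl.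
Qed.

End QuadraticMonotone.

(** * An eigenfunction with equal end values is constant *)

Section Simplicity.
Variable R : realType.
Notation leb := (@lebesgue_measure R).
Notation I01 := (@I01 R).
Implicit Types f g h : R -> R.
Variable w : R -> R -> R.
Hypothesis gw : graphon w.
Hypothesis rw : robinsonian w.
Hypothesis a2 : A2 w.
Variable K : R.
Hypothesis lw : forall x y x' y', I01 x -> I01 y -> I01 x' -> I01 y' ->
    `|w x y - w x' y'| <= K * (`|x - x'| + `|y - y'|).
Notation kop := (kop w).
Notation d := (degree w).

Lemma robinsonian_le_right s t y : 0 <= s -> s <= t -> t < y -> y <= 1 -> w s y <= w t y.
Proof.
move=> s0 st ty y1; move: st; rewrite le_eqVlt => /predU1P[->//|st].
have sI : I01 s by apply/I01E; lra.
have tI : I01 t by apply/I01E; lra.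
have yI : I01 y by apply/I01E; lra.
rewrite (gw.2.1 _ _ sI yI) (gw.2.1 _ _ tI yI).
by have [+ _] := rw yI sI tI; apply; rewrite st ty.
Qed.

Lemma robinsonian_le_left s t y : 0 <= y -> y < s -> s <= t -> t <= 1 -> w t y <= w s y.
Proof.
move=> y0 ys st t1; move: st; rewrite le_eqVlt => /predU1P[->//|st].
have sI : I01 s by apply/I01E; lra.
have tI : I01 t by apply/I01E; lra.
have yI : I01 y by apply/I01E; lra.
rewrite (gw.2.1 _ _ sI yI) (gw.2.1 _ _ tI yI).
by have [_ +] := rw yI sI tI; apply; rewrite ys st.
Qed.

Lemma kop_diff C g s t : I01 s -> I01 t -> lipschitzI C g ->
  Int (fun y => (w t y - w s y) * g y) = kop g t - kop g s.
Proof.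
move=> sI tI lg; have ig := lipschitzI_itg lg.
rewrite /kop -IntB; [|exact: (itg_kernel gw lw)..].
by apply: eq_Int => y _; ring.
Qed.

Lemma kop_diff_shift C g s t a : I01 s -> I01 t -> lipschitzI C g ->
  Int (fun y => (w t y - w s y) * (g y - a)) = kop g t - kop g s - a * (d t - d s).
Proof.
move=> sI tI lg.
have lg' := lipschitzI_lin 1 (- a) lg (lipschitzI_cst 1).
have ig := lipschitzI_itg lg; have i1 := itg_cst (1 : R).
transitivity (Int (fun y => (w t y - w s y) * (1 * g y + - a * 1))).
  by apply: eq_Int => y _; ring.
rewrite (kop_diff sI tI lg') !(kop_lin gw lw)// !degreeE; ring.
Qed.

Lemma itg_diff C g s t : I01 s -> I01 t -> lipschitzI C g ->
  itg (fun y => (w t y - w s y) * g y).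
Proof.
move=> sI tI lg; have ig := lipschitzI_itg lg.
apply: eq_itg (itgB (itg_kernel gw lw tI ig) (itg_kernel gw lw sI ig)) => y _.
by ring.
Qed.

Variables m delta : R.
Hypothesis delta0 : 0 < delta.
Hypothesis md : forall x, I01 x -> m + delta <= d x.

Variables (f : R -> R) (L : R).
Hypothesis lf : lipschitzI L f.
Hypothesis ef : forall x, I01 x -> (d x - m) * f x = kop f x.
Notation F := (variation_on f).

Let K0 : 0 <= K := lipschitzI_ge0 (degree_lip gw lw).
Let L0 : 0 <= L := lipschitzI_ge0 lf.
Let lF : lipschitzI L F := variation_lip lf.

(** Difference of the eigenvalue equations at [s] and [t]; centring the integrand at [f t] leaves
    the coefficient [d s - m]. *)
Let eigen_diff s t : I01 s -> I01 t ->
  (d s - m) * (f t - f s) = Int (fun y => (w t y - w s y) * (f y - f t)).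
Proof.
move=> sI tI; rewrite (kop_diff_shift (f t) sI tI lf) -!ef//; ring.
Qed.

Section Defect.
Variables (phi : R -> R) (D a b : R).
Hypothesis lphi : lipschitzI D phi.
Hypothesis a0 : 0 <= a.
Hypothesis b1 : b <= 1.
Hypothesis phi0 : forall t y, a <= t -> t <= b -> 0 <= y -> y <= t -> phi y = 0.
Hypothesis phi1 : forall t y, a <= t -> t <= b -> t <= y -> y <= 1 ->
  `|f y - f t| <= F y - F t - phi y.

(** This is [(L - m) F + W phi], where [phi y] is a guaranteed shortfall of [|f y - f t|] below
    [F y - F t] for [t] in [[a, b]] and [y >= t]. With [phi = 0] it is the [u] of the overview. *)
Let v x := (d x - m) * F x - kop F x + kop phi x.

(** The Robinson property fixes the sign of [w t y - w s y] for [y < s] and for [y > t], where [F]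
    and [phi] bound [|f y - f t|]. The strip between costs only a quadratic error. *)
Let step s t : a <= s -> s <= t -> t <= b ->
  (d s - m) * `|f t - f s| <=
  (d s - m) * (F t - F s) - (v t - v s) + 2 * K * L * (t - s) ^+ 2.
Proof.
move: a0 b1 K0 L0 => a0' b1' K0' L0' as_ st tb.
have sI : I01 s by apply/I01E; lra.
have tI : I01 t by apply/I01E; lra.
have ds : 0 < d s - m by have := md sI; have := delta0; lra.
have -> : (d s - m) * (F t - F s) - (v t - v s) =
    Int (fun y => (w t y - w s y) * (1 * (F y - F t) + (-1) * phi y)).
  have lFp := lipschitzI_lin 1 (-1) lF lphi.
  transitivity (Int (fun y => (w t y - w s y) * ((1 * F y + (-1) * phi y) - F t))).
    rewrite (kop_diff_shift (F t) sI tI lFp) !(kop_lin gw lw)//;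
      try exact: lipschitzI_itg lF; try exact: lipschitzI_itg lphi.
    by rewrite /v; ring.
  by apply: eq_Int => y _; ring.
rewrite -[X in X * `|_|](ger0_norm (ltW ds)) -normrM eigen_diff//.
set e := 2 * K * L * (t - s) ^+ 2.
have lFt : lipschitzI (L + 0) (fun y => F y - F t).
  by move=> x y xI yI; rewrite opprB addrA subrK addr0; exact: lF.
have lft : lipschitzI (L + 0) (fun y => f y - f t).
  by move=> x y xI yI; rewrite opprB addrA subrK addr0; exact: lf.
have i1 := itg_diff sI tI (lipschitzI_lin 1 (-1) lFt lphi).
have i2 := itg_diff sI tI lft.
(* As an integral over an interval of length 1, the error joins the integrand and the comparison
   becomes pointwise. *)
have -> : e = Int (fun=> e) by rewrite Int_cst.
rewrite -IntD//; last exact: itg_cst.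
apply: Int_norm_le => //; first exact: itgD i1 (itg_cst e).
move=> y yI; have /andP[y0 y1] := (I01E y).1 yI.
rewrite normrM.
have e0 : 0 <= e.
  by rewrite /e; apply: mulr_ge0; [apply: mulr_ge0 => //; apply: mulr_ge0|exact: sqr_ge0].
have [ys|sy] := ltP y s.
  have ww := robinsonian_le_left y0 ys st (le_trans tb b1').
  have yt : y <= t by lra.
  rewrite (phi0 (le_trans as_ st) tb y0 yt) mulr0 addr0 mul1r.
  have := variation_ge lf y0 yt (le_trans tb b1'); rewrite distrC => ff.
  rewrite ler0_norm ?subr_le0//.
  have : 0 <= (w s y - w t y) * (F t - F y - `|f y - f t|).
    by apply: mulr_ge0; rewrite subr_ge0.
  lra.
have [ty|yt] := ltP t y.
  have s0 := le_trans a0' as_.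
  have ww := robinsonian_le_right s0 st ty y1.
  have ff := phi1 (le_trans as_ st) tb (ltW ty) y1.
  rewrite ger0_norm ?subr_ge0//.
  have : 0 <= (w t y - w s y) * (F y - F t - phi y - `|f y - f t|).
    by apply: mulr_ge0; rewrite subr_ge0.
  lra.
(* On the strip [s <= y <= t] both factors are of order [t - s]; the terms of [f] and of [F] give
   the factor 2 in [e]. *)
have wK : `|w t y - w s y| <= K * (t - s).
  by apply: le_trans (graphon_col_lip lw yI tI sI) _; rewrite ger0_norm ?subr_ge0.
have fL : `|f y - f t| <= L * (t - s).
  apply: le_trans (lf yI tI) _; rewrite ler_wpM2l// distrC ger0_norm ?subr_ge0//; lra.
have FL : `|F y - F t| <= L * (t - s).
  apply: le_trans (lF yI tI) _; rewrite ler_wpM2l// distrC ger0_norm ?subr_ge0//; lra.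
rewrite (phi0 (le_trans as_ st) tb y0 yt) mulr0 addr0 mul1r.
have h1 : `|w t y - w s y| * `|f y - f t| <= K * (t - s) * (L * (t - s)).
  exact: ler_pM.
have h2 : `|w t y - w s y| * `|F y - F t| <= K * (t - s) * (L * (t - s)).
  exact: ler_pM.
have : - ((w t y - w s y) * (F y - F t)) <= `|w t y - w s y| * `|F y - F t|.
  by rewrite -normrM -normrN ler_norm.
have -> : e = 2 * (K * (t - s) * (L * (t - s))) by rewrite /e; ring.
lra.
Qed.

Let quadratic x x' : a <= x -> x <= x' -> x' <= b ->
  v x' - v x <= (3 * K * L) * (x' - x) ^+ 2.
Proof.
move: a0 b1 K0 L0 => a0' b1' K0' L0' ax xx' xb.
have xI : I01 x by apply/I01E; lra.
have D0 : 0 < d x - m by have := md xI; have := delta0; lra.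
(* The step inequality makes [H] dominate [f] on [x, x'], so that minimality of
   [F] compares [F] with [H]. *)
pose H t := F t + (d x - m)^-1 * (3 * K * L * (x' - x) * t - v t).
have x0 : 0 <= x by lra.
have x1 : x' <= 1 by lra.
suff /(variation_le lf x0 xx' x1) : dominates f H x x'.
  rewrite /H => FH.
  have : 0 <= (d x - m)^-1 * (3 * K * L * (x' - x) ^+ 2 - (v x' - v x)) by lra.
  by rewrite pmulr_rge0 ?invr_gt0// subr_ge0.
move=> s t xs st tx.
have sI : I01 s by apply/I01E; lra.
have s1 : s <= 1 by lra.
have h := step (le_trans ax xs) st (le_trans tx xb).
have h1 := variation_ge lf (le_trans x0 xs) st (le_trans tx x1).
have h2 : F t - F s <= L * (t - s).
  have tI : I01 t by apply/I01E; lra.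
  apply: le_trans (ler_norm _) _; apply: le_trans (lF tI sI) _.
  by rewrite ger0_norm ?subr_ge0.
(* Freezing the coefficient [d s] at [d x] costs a further [K * L], hence the constant 3. *)
have dd : `|d s - d x| <= K * (x' - x).
  apply: le_trans (degree_lip gw lw sI xI) _; rewrite ler_wpM2l// ger0_norm ?subr_ge0//; lra.
have h3 : (d s - d x) * (F t - F s - `|f t - f s|) <= K * (x' - x) * (L * (t - s)).
  apply: le_trans (ler_norm _) _; rewrite normrM; apply: ler_pM => //.
  rewrite ger0_norm ?subr_ge0//; have := normr_ge0 (f t - f s); lra.
have h4 : K * L * (t - s) ^+ 2 <= K * L * ((x' - x) * (t - s)).
  apply: ler_wpM2l; first exact: mulr_ge0.
  by rewrite expr2; apply: ler_wpM2r; lra.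
have h5 : (d x - m) * `|f t - f s| <=
    (d x - m) * (F t - F s) + (3 * K * L * (x' - x) * (t - s) - (v t - v s)).
  lra.
have -> : H t - H s = (d x - m)^-1 * ((d x - m) * (F t - F s) +
    (3 * K * L * (x' - x) * (t - s) - (v t - v s))).
  by rewrite /H; field; rewrite gt_eqF.
by rewrite ler_pdivlMl.
Qed.

Lemma defect_nonincreasing : a <= b ->
  (d b - m) * F b - kop F b + kop phi b <= (d a - m) * F a - kop F a + kop phi a.
Proof. exact: (nonincreasing_of_quadratic quadratic). Qed.

End Defect.

Let u x := (d x - m) * F x - kop F x.

Let u_nonincreasing x y : 0 <= x -> x <= y -> y <= 1 -> u y <= u x.
Proof.
move=> x0 xy y1.
have k0 z : kop (fun=> 0) z = 0.
  by rewrite -[RHS](@Int_cst R); apply: eq_Int => t _; rewrite mulr0.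
have := @defect_nonincreasing (fun=> 0) 0 x y (lipschitzI_cst 0) x0 y1 _ _ xy.
rewrite !k0 !addr0; apply => // t z xt ty tz z1; rewrite subr0.
by apply: (variation_ge lf) => //; exact: le_trans xt.
Qed.

Let u_lip : exists E, lipschitzI E u.
Proof.
have ld : lipschitzI (K + 0) (fun x => d x - m).
  by move=> x y xI yI; rewrite opprB addrA subrK addr0; exact: (degree_lip gw lw).
have [E lE] := lipschitzIM ld lF.
have lk := kop_lip gw lw (lipschitzI_itg lF).
exists (`|1| * E + `|-1| * (K * Int (fun y => `|F y|))) => x y xI yI.
have := lipschitzI_lin 1 (-1) lE lk xI yI.
by rewrite /u !mul1r !mulN1r.
Qed.

Hypothesis minm : forall h, L2 h -> Int h = 0 -> m * ip h h <= ip (lap w h) h.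

(* [u] is nonincreasing and [F] nondecreasing, so Chebyshev's inequality makes
   the centred [F] a minimizer of the Rayleigh quotient; hence an eigenfunction. *)
Let u_const x : I01 x -> u x = u 0.
Proof.
have I0 : I01 0 by apply/I01E; lra.
have I1 : I01 1 by apply/I01E; lra.
have Fmono s t : 0 <= s -> s <= t -> t <= 1 -> F s <= F t.
  by move=> s0 st t1; have := variation_ge lf s0 st t1; have := normr_ge0 (f t - f s); lra.
have itF := lipschitzI_itg lF.
pose c := Int F.
have c0 : F 0 <= c.
  rewrite -[leLHS](@Int_cst R); apply: Int_le => //; first exact: itg_cst.
  by move=> y /I01E/andP[y0 y1]; exact: Fmono.
have c1 : c <= F 1.
  rewrite -[leRHS](@Int_cst R); apply: Int_le => //; first exact: itg_cst.
  by move=> y /I01E/andP[y0 y1]; exact: Fmono.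
(* At [z] the function [F] takes its mean, so [F - c] and [u - u z] have opposite signs on either
   side of [z]. *)
have [z z01 Fz] : exists2 z, z \in `[0, 1] & F z = c.
  apply: IVT => //; first exact: lipschitzI_continuous lF.
  by rewrite ge_min le_max c0 c1 orbT.
have /I01E/andP[z0 z1] : I01 z by [].
pose h x := 1 * F x + (- c) * 1.
have lh := lipschitzI_lin 1 (- c) lF (lipschitzI_cst 1).
have l2h : L2 h by exact: lipschitzI_L2 lh.
have Ih : Int h = 0.
  rewrite /h IntD; [|exact: itgZ|exact: itg_cst].
  by rewrite IntZ// Int_cst -/c; ring.
have [E lu] := u_lip.
have lapu y : I01 y -> lap w h y - m * h y = u y + m * c.
  move=> yI; rewrite (lapE gw lw)//; last exact: L2_itg.
  rewrite (kop_lin gw lw)//; last exact: itg_cst.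
  by rewrite -degreeE /u /h; ring.
have uh : ip (fun y => u y + m * c) h <= 0.
  have lum := lipschitzI_lin 1 (m * c) lu (lipschitzI_cst 1).
  have luz := lipschitzI_lin 1 (- u z) lu (lipschitzI_cst 1).
  have -> : ip (fun y => u y + m * c) h = ip (fun y => 1 * u y + - u z * 1) h.
    rewrite (@eq_ip _ _ (fun y => 1 * u y + (m * c) * 1)); last by move=> y _; ring.
    rewrite !ip_lin//; try exact: lipschitzI_L2 lu; try exact: L2_cst.
    by rewrite (ipC (fun=> 1) h) ip1E Ih !mulr0.
  rewrite -oppr_ge0 -mulN1r -IntZ; last first.
    by apply: L2_itgM => //; exact: lipschitzI_L2 luz.
  apply: Int_ge0 => y /I01E/andP[y0 y1].
  have -> : -1 * ((1 * u y + - u z * 1) * h y) = (u z - u y) * (F y - F z).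
    by rewrite /h Fz; ring.
  have [yz|/ltW zy] := leP y z.
    by apply: mulr_le0; rewrite subr_le0; [exact: u_nonincreasing|exact: Fmono].
  by apply: mulr_ge0; rewrite subr_ge0; [exact: u_nonincreasing|exact: Fmono].
pose S : set (R -> R) := [set (fun=> 1)].
have eS : eigenfamily w S.
  move=> _ ->; exists 0; split; first exact: L2_cst.
  exists set0; split => // t /= nt; apply: nt => tI.
  by rewrite lap_cst// mul0r.
have S0 : orth S (fun=> 0).
  split; first exact: L2_cst.
  by move=> g _; rewrite -[RHS](@Int_cst R); apply: eq_Int => y _; rewrite mul0r.
have ip0 g : ip (fun=> 0) g = 0.
  by rewrite -[RHS](@Int_cst R); apply: eq_Int => y _; rewrite mul0r.
have E0 g : orth S g -> 0 <= energy w m (fun=> 0) g.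
  move=> [lg Sg]; rewrite /energy ip0 mulr0 subr0 subr_ge0; apply: minm => //.
  by rewrite -ip1E; exact: Sg.
have Sh : orth S h by split => // _ ->; rewrite ip1E.
(* Zero excess over the lower bound 0: [energy_step] then makes the residual of [h], which is [u]
   plus a constant, vanish. *)
have Eh : energy w m (fun=> 0) h <= 0 + 0.
  rewrite /energy ip0 mulr0 subr0 addr0 -ipZl// -ipBl//; [|exact: (lap_L2 gw lw)|exact: L2Z].
  by apply: le_trans uh; rewrite (eq_ip _ lapu).
have := energy_step gw lw eS S0 E0 Sh Eh; rewrite mulr0 => rr.
have [lr _] : orth S (residual w m (fun=> 0) h) by exact: (orth_residual gw lw).
have rE y : I01 y -> residual w m (fun=> 0) h y = 1 * u y + (m * c) * 1.
  by move=> yI; rewrite /residual subr0 lapu//; ring.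
have r0 : ae_zero (residual w m (fun=> 0) h).
  by apply: ip_eq0 => //; apply: le_anti; rewrite rr ip_ge0.
have r0' : ae_zero (fun y => 1 * u y + (m * c) * 1).
  by rewrite /ae_zero /ae_eq; apply: (ae_mono r0) => y yI <-; rewrite rE.
have uc := lipschitzI_ae0 (lipschitzI_lin 1 (m * c) lu (lipschitzI_cst 1)) r0'.
by move=> xI; have := uc _ xI; have := uc _ I0; lra.
Qed.

Hypothesis f01 : f 0 = f 1.

Lemma eigen_equal_ends_const x : I01 x -> f x = f 0.
Proof.
move: K0 L0 => K0' L0'.
have I0 : I01 0 by apply/I01E; lra.
have I1 : I01 1 by apply/I01E; lra.
have [F10|eta0] := leP (F 1 - F 0) 0.
  move=> /I01E/andP[x0 x1]; apply/eqP; rewrite -subr_eq0 -normr_le0.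
  have := variation_ge lf (lexx _) x0 x1; have := variation_ge lf x0 x1 (lexx _).
  have := normr_ge0 (f 1 - f x); lra.
exfalso.
set eta := F 1 - F 0 in eta0.
have etaL : eta <= L.
  have := lF I1 I0; rewrite subr0 normr1 mulr1; exact: le_trans (ler_norm _).
have Lgt0 : 0 < L by lra.
(* For [t <= b], both [f] and [F] move by at most [eta / 4] from their values at 0. *)
pose b := eta / (4 * L).
have bL : L * b = eta / 4 by rewrite /b; field; rewrite gt_eqF.
have b0 : 0 < b by rewrite divr_gt0// mulr_gt0.
have b4 : b <= 1 / 4 by rewrite ler_pdivrMr ?mulr_gt0//; lra.
(* As [f 0 = f 1], [|f y - f t|] is at most [L * (1 - y) + L * t], whereas [F y - F t] is at least
   [eta] minus that sum. With [L * t <= eta / 4] the gap is at least [eta / 2 - 2 * L * (1 - y)]. *)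
pose phi y := Num.max 0 (eta / 2 - 2 * L * (1 - y)).
have lphi : lipschitzI (2 * L) phi.
  move=> x1 y1 _ _; rewrite /phi; have := ler_norm (x1 - y1).
  have := ler_norm (y1 - x1); rewrite distrC => h1 h2.
  have {}h1 : 2 * L * (y1 - x1) <= 2 * L * `|x1 - y1| by rewrite ler_wpM2l//; lra.
  have {}h2 : 2 * L * (x1 - y1) <= 2 * L * `|x1 - y1| by rewrite ler_wpM2l//; lra.
  have h3 : 0 <= 2 * L * `|x1 - y1| by rewrite mulr_ge0//; lra.
  rewrite ler_norml !maxEle; case: ifP => ? ; case: ifP => ?; lra.
have phi_ge0 y : 0 <= phi y by rewrite le_max lexx.
have phi0 t y : 0 <= t -> t <= b -> 0 <= y -> y <= t -> phi y = 0.
  move=> t0 tb y0 yt; rewrite /phi; apply/max_idPl.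
  have : 2 * L * (3 / 4) <= 2 * L * (1 - y) by rewrite ler_wpM2l//; lra.
  lra.
have phi1 t y : 0 <= t -> t <= b -> t <= y -> y <= 1 ->
    `|f y - f t| <= F y - F t - phi y.
  move=> t0 tb ty y1.
  have tI : I01 t by apply/I01E; lra.
  have yI : I01 y by apply/I01E; lra.
  have h1 := variation_ge lf t0 ty y1.
  have h2 := le_trans (ler_norm _) (lF I1 yI).
  have h3 := le_trans (ler_norm _) (lF tI I0).
  have h4 := lf yI I1; have h5 := lf tI I0.
  have h6 : `|f y - f t| <= `|f y - f 1| + `|f t - f 0|.
    have -> : f y - f t = (f y - f 1) - (f t - f 0) by rewrite f01; ring.
    exact: ler_normB.
  have a1 : `|1 - y| = 1 - y by rewrite ger0_norm ?subr_ge0.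
  have a2' : `|t - 0| = t by rewrite subr0 ger0_norm.
  rewrite a1 in h2; rewrite [`|y - 1|]distrC a1 in h4; rewrite a2' in h3 h5.
  have h7 : L * t <= L * b by rewrite ler_wpM2l.
  rewrite /phi maxEle; case: ifP => _; last by lra.
  rewrite /eta in bL *; lra.
have b1 : b <= 1 by lra.
have bI : I01 b by apply/I01E; lra.
(* The values of [u] at 0 and [b] cancel, leaving [W phi b <= W phi 0]; but the integrand [psi] of
   the difference is nonnegative, so it vanishes. *)
have := defect_nonincreasing lphi (lexx 0) b1 phi0 phi1 (ltW b0).
rewrite -!/(u _) u_const// lerD2l -subr_le0 -(kop_diff I0 bI lphi) => psi_le0.
pose psi y := (w b y - w 0 y) * phi y.
have psi_ge0 y : I01 y -> 0 <= psi y.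
  move=> /I01E/andP[y0 y1]; have [yb|by_] := leP y b.
    by rewrite /psi (phi0 b)// ?mulr0// ltW.
  by rewrite mulr_ge0// subr_ge0 (robinsonian_le_right (lexx 0) (ltW b0)).
have lw0 : lipschitzI (`|1| * K + `|-1| * K) (fun y => 1 * w b y + (-1) * w 0 y).
  by apply: lipschitzI_lin; exact: (graphon_row_lip lw).
have [E lpsi0] := lipschitzIM lw0 lphi.
have lpsi : lipschitzI E psi.
  by move=> s t sI tI; have := lpsi0 s t sI tI; rewrite /psi !mul1r !mulN1r.
have psi0 := lipschitzI_Int0 lpsi psi_ge0.
have {}psi0 y : I01 y -> psi y = 0.
  by apply: psi0; apply: le_anti; rewrite psi_le0 Int_ge0.
have hbI : I01 (b / 2) by apply/I01E; lra.
have ob0 : 0 <= 1 - b by lra.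
have ob1 : 1 - b < 1 by lra.
(* For [y > 1 - b] the factor [phi y] is positive, so [w b y = w 0 y]. By monotonicity [w t y] is
   then constant for [t] in [[0, b]], against the nonzero derivative at [b / 2]. *)
have [y [yb y1 [l [dl /negP l0]]]] := ae_meets_interval (a2 hbI) ob0 ob1 (lexx 1).
have yI : I01 y by apply/I01E; lra.
have phiy : phi y != 0.
  rewrite gt_eqF// /phi lt_max; apply/orP; right.
  have : 2 * L * (1 - y) < 2 * L * b by rewrite ltr_pM2l ?mulr_gt0//; lra.
  lra.
have wb : w b y = w 0 y.
  have /eqP := psi0 y yI; rewrite mulf_eq0 (negbTE phiy) orbF subr_eq0.
  by move/eqP.
have wt t : 0 <= t -> t <= b -> w t y = w (b / 2) y.
  have H s : 0 <= s -> s <= b -> w s y = w 0 y.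
    move=> s0 sb; apply: le_anti.
    rewrite -{1}wb (robinsonian_le_right s0 sb) ?(robinsonian_le_right (lexx 0) s0)//; lra.
  by move=> t0 tb; rewrite !H//; lra.
apply: l0; rewrite -normr_le0; apply/ler_addgt0Pr => e e0.
have /cvgrPdist_lt/(_ _ e0) := dl.
move=> [r /= r0 rP].
have r0' : 0 < r by [].
(* A point other than [b / 2], within [r] of it and still below [b]. *)
pose t := b / 2 + Num.min r b / 4.
have mb : Num.min r b <= b by rewrite ge_min lexx orbT.
have mr : Num.min r b <= r by rewrite ge_min lexx.
have m0 : 0 < Num.min r b by rewrite lt_min r0' b0.
have := rP t; rewrite wt ?subrr ?mul0r ?subr0; [|rewrite /t; lra..].
rewrite add0r => /(_ _ _ _)/ltW; apply.
- rewrite /= /t opprD addrA subrr sub0r normrN gtr0_norm; lra.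
- by apply/eqP => tb; move: tb; rewrite /t; lra.
- apply/I01E; rewrite /t; lra.
Qed.

End Simplicity.

(** * The bottom [m] is nonzero and its eigenspace is a line *)

Section BottomEigenvalue.
Variable R : realType.
Notation leb := (@lebesgue_measure R).
Notation I01 := (@I01 R).
Implicit Types f g h : R -> R.
Variable w : R -> R -> R.
Hypothesis gw : graphon w.
Hypothesis a2 : A2 w.
Variable K : R.
Hypothesis lw : forall x y x' y', I01 x -> I01 y -> I01 x' -> I01 y' ->
    `|w x y - w x' y'| <= K * (`|x - x'| + `|y - y'|).
Notation kop := (kop w).
Notation d := (degree w).

(** As [w] is nonnegative, [x] is an interior minimum of [w^~ y]: the difference quotients on the
    two sides have opposite signs. *)
Lemma derivI_interior_zero x y l : 0 < x -> x < 1 -> I01 y ->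
  derivI (w^~ y) x l -> w x y = 0 -> l = 0.
Proof.
move=> x0 x1 yI dl wxy; apply/eqP; rewrite -normr_le0; apply/ler_addgt0Pr => e e0.
have /cvgrPdist_lt/(_ _ e0)[r /= r0 rP] := dl.
have {}r0 : 0 < r by [].
pose q := Num.min r (Num.min x (1 - x)).
have [q0 qr qx qx1] : [/\ 0 < q, q <= r, q <= x & q <= 1 - x].
  by rewrite /q !lt_min !ge_min !lexx !orbT r0 x0 subr_gt0 x1.
have near t : I01 t -> t != x -> `|x - t| < r -> `|l - w t y / (t - x)| < e.
  by move=> tI tx xt; have := rP t xt tx tI; rewrite wxy subr0.
have tI : I01 (x + q / 2) by apply/I01E; lra.
have sI : I01 (x - q / 2) by apply/I01E; lra.
have h1 : `|l - w (x + q / 2) y / (q / 2)| < e.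
  have := near _ tI; have -> : x + q / 2 - x = q / 2 by ring.
  apply; first by apply/eqP; lra.
  by have -> : x - (x + q / 2) = - (q / 2) by [ring]; rewrite normrN gtr0_norm; lra.
have h2 : `|l + w (x - q / 2) y / (q / 2)| < e.
  have := near _ sI; have -> : x - q / 2 - x = - (q / 2) by ring.
  rewrite invrN mulrN opprK; apply; first by apply/eqP; lra.
  by have -> : x - (x - q / 2) = q / 2 by [ring]; rewrite gtr0_norm; lra.
have /andP[t0 _] := gw.2.2 _ _ tI yI; have /andP[s0 _] := gw.2.2 _ _ sI yI.
have : 0 <= w (x + q / 2) y / (q / 2) by apply: divr_ge0 => //; lra.
have : 0 <= w (x - q / 2) y / (q / 2) by apply: divr_ge0 => //; lra.
move: h1 h2; rewrite !ltr_norml => /andP[h1 h2] /andP[h3 h4] h5 h6.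
by rewrite ler_norml; lra.
Qed.

Lemma graphon_neq0 x : 0 < x -> x < 1 -> {ae leb, forall y, I01 y -> w x y != 0}.
Proof.
move=> x0 x1; have xI : I01 x by apply/I01E; lra.
apply: (ae_mono (a2 xI)) => y yI [l [dl l0]]; apply/eqP => wxy.
by move/eqP: l0; apply; exact: derivI_interior_zero dl wxy.
Qed.

Lemma lipschitzI_interior0 C g : lipschitzI C g ->
  (forall y, 0 < y -> y < 1 -> g y = 0) -> forall y, I01 y -> g y = 0.
Proof.
move=> lg g0; apply: (lipschitzI_ae0 lg).
exists ([set 0] `|` [set 1]); split.
- by apply: measurableU; exact: measurable_set1.
- by apply: null_set_setU; first [exact: measurable_set1|exact: lebesgue_measure_set1].
- move=> y /= ny; apply: contrapT => /not_orP[y0 y1]; apply: ny => /I01E/andP[y0' y1'].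
  apply: g0; rewrite lt_neqAle ?y0' ?y1' andbT; apply/eqP => // e; exact: y0.
Qed.

(** Maximum principle: at a maximum [x] the integrand of [lap w f x] is nonnegative with integral 0,
    so [f] equals its maximum wherever [w x] is nonzero. *)
Lemma harmonic_const C f : lipschitzI C f -> (forall x, I01 x -> 0 < d x) ->
  (forall x, I01 x -> lap w f x = 0) -> exists a, forall x, I01 x -> f x = a.
Proof.
move=> lf d0 hf.
have [x0 x0I fmax] : exists2 c, c \in `[0, 1] & forall t, t \in `[0, 1] -> f t <= f c.
  by apply: EVT_max => //; exact: lipschitzI_continuous lf.
have prod0 x : I01 x -> f x = f x0 -> forall y, I01 y -> w x y * (f x - f y) = 0.
  move=> xI fx.
  have lg := lipschitzI_lin (f x) (-1) (lipschitzI_cst 1) lf.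
  have [E lE] := lipschitzIM (graphon_row_lip lw xI) lg.
  have lE' : lipschitzI E (fun y => w x y * (f x - f y)).
    by move=> s t sI tI; have := lE s t sI tI; rewrite !mulr1 !mulN1r.
  apply: (lipschitzI_Int0 lE'); last exact: hf.
  move=> y yI; apply: mulr_ge0; first by case/andP: (gw.2.2 _ _ xI yI).
  by rewrite subr_ge0 fx fmax.
(* [graphon_neq0] needs an interior point. If none reached the maximum, [w x0] would vanish on the
   interior, hence everywhere, against [d x0 > 0]. *)
have [x [xgt0 xlt1 fx]] : exists x, [/\ 0 < x, x < 1 & f x = f x0].
  apply: contrapT => nx.
  have w0 : forall y, I01 y -> w x0 y = 0.
    apply: (lipschitzI_interior0 (graphon_row_lip lw x0I)) => y y0 y1.
    have yI : I01 y by apply/I01E; lra.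
    have /eqP := prod0 x0 x0I erefl y yI; rewrite mulf_eq0 => /orP[/eqP//|].
    by rewrite subr_eq0 => /eqP e; exfalso; apply: nx; exists y.
  have := d0 x0 x0I; suff -> : d x0 = 0 by rewrite ltxx.
  by rewrite -[RHS](@Int_cst R); apply: eq_Int => y /w0.
exists (f x0) => y yI.
have xI : I01 x by apply/I01E; lra.
have lg := lipschitzI_lin 1 (- f x0) lf (lipschitzI_cst 1).
have ae0 : ae_zero (fun y => 1 * f y + - f x0 * 1).
  rewrite /ae_zero /ae_eq; apply: (ae_mono (graphon_neq0 xgt0 xlt1)) => z zI wz.
  have /eqP := prod0 x xI fx z zI; rewrite mulf_eq0 (negbTE wz) /= fx => /eqP; lra.
by have := lipschitzI_ae0 lg ae0 yI; lra.
Qed.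

Variables m delta : R.
Hypothesis delta0 : 0 < delta.
Hypothesis md : forall x, I01 x -> m + delta <= d x.

(** The eigenvalue equation solved for [f]: the Lipschitz representative of an eigenfunction. *)
Definition smooth_rep f x := (d x - m)^-1 * kop f x.

Lemma eigfun_ae f : eigfun w m f -> ae_eq f (smooth_rep f).
Proof.
move=> [lf ef]; rewrite /ae_eq; apply: (ae_mono ef) => x xI.
have dx := degree_sub_gt0 delta0 md xI.
rewrite (lapE gw lw) ?(L2_itg lf)// => e; rewrite /smooth_rep.
have -> : kop f x = (d x - m) * f x by lra.
by rewrite mulKf// gt_eqF.
Qed.

Lemma smooth_rep_lip f : itg f -> exists C, lipschitzI C (smooth_rep f).
Proof.
move=> itf.
exact: lipschitzIM (inv_degree_lip gw lw delta0 md) (kop_lip gw lw itf).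
Qed.

Lemma smooth_rep_eq f x : eigfun w m f -> I01 x ->
  (d x - m) * smooth_rep f x = kop (smooth_rep f) x.
Proof.
move=> ef xI; have dx := degree_sub_gt0 delta0 md xI.
have itf := L2_itg ef.1; have [C lC] := smooth_rep_lip itf.
rewrite -(kop_ae gw lw xI itf (lipschitzI_itg lC) (eigfun_ae ef)).
by rewrite /smooth_rep mulVKf// gt_eqF.
Qed.

Lemma eigfun_const_ae0 f a : L2 f -> Int f = 0 -> ae_eq f (fun=> a) -> ae_zero f.
Proof.
move=> lf If fa.
have := Int_ae_eq (L2_measurable lf) (L2_measurable (L2_cst a)) fa.
by rewrite If Int_cst => a0; move: fa; rewrite -a0.
Qed.

(** If [m = 0], the representative is harmonic, hence constant, and a constant of mean zero is
    zero. *)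
Lemma bottom_neq0 f : eigfun w m f -> Int f = 0 -> ~ ae_zero f -> m != 0.
Proof.
move=> ef If nf; apply/eqP => m0; apply: nf.
have itf := L2_itg ef.1; have [C lC] := smooth_rep_lip itf.
have [||a fa] := harmonic_const lC.
- by move=> x xI; have := md xI; have := delta0; rewrite m0; lra.
- move=> x xI; rewrite (lapE gw lw)//; last exact: lipschitzI_itg lC.
  by rewrite -smooth_rep_eq// m0; ring.
apply: (@eigfun_const_ae0 f a ef.1 If).
by rewrite /ae_eq; apply: (ae_mono (eigfun_ae ef)) => x xI ->; exact: fa.
Qed.

Hypothesis rw : robinsonian w.
Hypothesis minm : forall h, L2 h -> Int h = 0 -> m * ip h h <= ip (lap w h) h.

Lemma eigfun_ends_ae0 f : eigfun w m f -> Int f = 0 ->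
  smooth_rep f 0 = smooth_rep f 1 -> ae_zero f.
Proof.
move=> ef If f01.
have itf := L2_itg ef.1; have [C lC] := smooth_rep_lip itf.
apply: (@eigfun_const_ae0 f (smooth_rep f 0) ef.1 If).
rewrite /ae_eq; apply: (ae_mono (eigfun_ae ef)) => x xI ->.
by apply: (eigen_equal_ends_const gw rw a2 lw delta0 md lC) => // y yI; exact: smooth_rep_eq.
Qed.

Lemma eigfun_lin a b f g : eigfun w m f -> eigfun w m g ->
  eigfun w m (fun x => a * f x + b * g x).
Proof.
move=> [lf ef] [lg eg]; split; first exact: L2_lin.
rewrite /ae_eq; apply: (ae_mono2 ef eg) => x xI fx gx.
by rewrite (lap_lin gw lw) ?L2_itg// fx gx; ring.
Qed.

Lemma eigfun_Int0 mu f : mu != 0 -> eigfun w mu f -> Int f = 0.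
Proof.
move=> mu0 [lf ef]; have lmf := L2Z mu lf; have llf := lap_L2 gw lw lf.
have := Int_ae_eq (L2_measurable llf) (L2_measurable lmf) ef.
rewrite (Int_lap gw lw)// IntZ; last exact: L2_itg.
by move=> /esym/eqP; rewrite mulf_eq0 (negbTE mu0) => /eqP.
Qed.

(** The linear form [smooth_rep f 1 - smooth_rep f 0] is injective on the eigenspace by
    [eigfun_ends_ae0]; [c] is the ratio of its values at [f] and [f0]. *)
Lemma eigfun_proportional f0 f : m != 0 -> eigfun w m f0 -> ~ ae_zero f0 -> eigfun w m f ->
  exists c, ae_eq f (fun x => c * f0 x).
Proof.
move=> m0 ef0 nf0 ef.
have [If If0] := (eigfun_Int0 m0 ef, eigfun_Int0 m0 ef0).
have D0 : smooth_rep f0 1 - smooth_rep f0 0 != 0.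
  by apply/eqP => e; apply/nf0/eigfun_ends_ae0 => //; lra.
pose c := (smooth_rep f 1 - smooth_rep f 0) / (smooth_rep f0 1 - smooth_rep f0 0).
have itf := L2_itg ef.1; have itf0 := L2_itg ef0.1.
have rep x : I01 x -> smooth_rep (fun x => 1 * f x + (- c) * f0 x) x =
    smooth_rep f x - c * smooth_rep f0 x.
  by move=> xI; rewrite /smooth_rep (kop_lin gw lw)//; ring.
exists c.
have /eigfun_ends_ae0 : eigfun w m (fun x => 1 * f x + (- c) * f0 x) by exact: eigfun_lin.
move=> H; have : ae_zero (fun x => 1 * f x + (- c) * f0 x).
  apply: H.
    rewrite IntD; [|exact: itgZ..].
    by rewrite !IntZ// If If0; ring.
  have I0 : I01 0 by apply/I01E; lra.
  have I1 : I01 1 by apply/I01E; lra.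
  rewrite !rep//.
  have : c * (smooth_rep f0 1 - smooth_rep f0 0) = smooth_rep f 1 - smooth_rep f 0.
    by rewrite /c divfK.
  lra.
move=> H0; rewrite /ae_eq; apply: (ae_mono H0) => x xI; lra.
Qed.

End BottomEigenvalue.

(** * Attainment of the bottom, the gap above it and the resolvent *)

Section SpectralGap.
Variable R : realType.
Notation leb := (@lebesgue_measure R).
Notation I01 := (@I01 R).
Implicit Types f g h : R -> R.
Variable w : R -> R -> R.
Hypothesis gw : graphon w.
Variable K : R.
Hypothesis lw : forall x y x' y', I01 x -> I01 y -> I01 x' -> I01 y' ->
    `|w x y - w x' y'| <= K * (`|x - x'| + `|y - y'|).
Notation d := (degree w).

Lemma ip0l g : ip (fun=> 0) g = 0 :> R.
Proof. by rewrite -[RHS](@Int_cst R); apply: eq_Int => y _; rewrite mul0r. Qed.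

Lemma orth0 (S : set (R -> R)) : orth S (fun=> 0).
Proof. by split => [|h _]; [exact: L2_cst|exact: ip0l]. Qed.

Lemma eigfun_cst1 : eigfun w 0 (fun=> 1).
Proof.
split; first exact: L2_cst.
by exists set0; split => // x /= nx; apply: nx => xI; rewrite lap_cst// mul0r.
Qed.

Lemma eigfun_everywhere c f : L2 f -> (forall x, I01 x -> lap w f x - c * f x = 0) ->
  eigfun w c f.
Proof.
move=> lf ef; split => //; exists set0; split => // x /= nx; apply: nx => xI.
by have := ef x xI; lra.
Qed.

Lemma eigfun_ip c f g : eigfun w c f -> L2 g -> ip (lap w f) g = c * ip f g.
Proof.
move=> [lf ef] lg; rewrite -ipZl//; apply: ip_ae => //.
- exact: L2_measurable (lap_L2 gw lw lf).
- exact: L2_measurable (L2Z c lf).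
- exact: L2_measurable.
Qed.

Lemma ip_gt0 f : L2 f -> ~ ae_zero f -> 0 < ip f f.
Proof.
move=> lf nf; rewrite lt_neqAle ip_ge0 andbT eq_sym; apply/eqP => /(ip_eq0 lf).
exact: nf.
Qed.

(** If [f] were zero, the squared distances to it would all be 1, never below 1/2. *)
Lemma unit_limit_neq0 f (f_ : nat -> R -> R) : L2 f ->
  (forall n, L2 (f_ n)) -> (forall n, ip (f_ n) (f_ n) = 1) ->
  (forall e, 0 < e -> exists n,
      ip (fun x => f_ n x - f x) (fun x => f_ n x - f x) < e) -> ~ ae_zero f.
Proof.
move=> lf lfn fn1 fe f0.
have [|n] := fe (1/2); first by lra.
have lB := L2B (lfn n) lf.
have -> : ip (fun x => f_ n x - f x) (fun x => f_ n x - f x) = 1.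
  rewrite -(fn1 n); apply: Int_ae_eq.
  - exact: itg_measurable (L2_itgM lB lB).
  - exact: itg_measurable (L2_itgM (lfn n) (lfn n)).
  - by rewrite /ae_eq; apply: (ae_mono f0) => x _ ->; rewrite subr0.
lra.
Qed.

Lemma normalize S f : orth S f -> 0 < ip f f -> eigenfamily w S ->
  exists g, [/\ orth S g, ip g g = 1 & ip (lap w g) g = ip (lap w f) f / ip f f].
Proof.
move=> Sf f0 eS; pose s := (Num.sqrt (ip f f))^-1.
have s2 : s ^+ 2 = (ip f f)^-1 by rewrite exprVn sqr_sqrtr// ltW.
exists (fun x => s * f x + 0 * f x); split.
- exact: (orth_lin _ _ eS Sf Sf).
- rewrite ip_sq_lin; [|by case: Sf..].
  by rewrite s2 expr0n /= mulVf ?gt_eqF//; ring.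
- rewrite (lap_quad gw lw); [|by case: Sf..].
  by rewrite s2 expr0n /= mulrC; ring.
Qed.

Lemma bottom_attained S c delta : 0 < delta -> (forall x, I01 x -> c + delta <= d x) ->
  eigenfamily w S -> (forall f, orth S f -> c * ip f f <= ip (lap w f) f) ->
  (forall e, 0 < e -> exists f, [/\ orth S f, 0 < ip f f &
    ip (lap w f) f <= (c + e) * ip f f]) ->
  exists f, [/\ orth S f, eigfun w c f & ~ ae_zero f].
Proof.
move=> delta0 cd eS cmin H.
have /choice[f_ hf] : forall n, exists f, [/\ orth S f, ip f f = 1 &
    energy w c (fun=> 0) f <= 0 + n.+1%:R^-1].
  move=> n; have [|f [Sf f0 fle]] := H n.+1%:R^-1; first by rewrite invr_gt0.
  have [g [Sg g1 lg]] := normalize Sf f0 eS; exists g; split => //.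
  rewrite /energy ip0l mulr0 subr0 g1 mulr1 lg add0r lerBlDl.
  by rewrite ler_pdivrMr.
have E0 f : orth S f -> 0 <= energy w c (fun=> 0) f.
  by move=> Sf; rewrite /energy ip0l mulr0 subr0 subr_ge0 cmin.
have [|f [Sf ef fe]] := energy_attained gw lw delta0 cd (M := 1) eS (orth0 S) E0 (f_ := f_).
  by move=> n; case: (hf n) => Sf f1 Ef; split => //; rewrite f1.
exists f; split => //.
- by apply: eigfun_everywhere => //; case: Sf.
- apply: (unit_limit_neq0 _ _ _ fe).
  + by case: Sf.
  + by move=> n; case: (hf n) => -[].
  + by move=> n; case: (hf n).
Qed.

(** Dirichlet principle: the solution is a minimizer of the energy with source [g]. *)
Lemma solve_coercive S c delta kappa g : 0 < delta ->
  (forall x, I01 x -> c + delta <= d x) -> 0 < kappa -> eigenfamily w S ->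
  (forall f, orth S f -> (c + kappa) * ip f f <= ip (lap w f) f) -> orth S g ->
  exists f, orth S f /\ forall x, I01 x -> lap w f x - c * f x = g x.
Proof.
move=> delta0 cd k0 eS coer Sg.
have lg : L2 g by case: Sg.
(* Young's inequality with weight [kappa / 2] absorbs the source term and leaves half of the
   coercivity. *)
have Elow f : orth S f ->
    kappa / 2 * ip f f - (kappa / 2)^-1 * ip g g <= energy w c g f.
  move=> Sf; have lf : L2 f by case: Sf.
  have k2 : 0 < kappa / 2 by lra.
  have := ip_young k2 lf lg; have := coer f Sf; rewrite /energy (ipC g f); lra.
pose A := [set energy w c g f | f in orth S].
have Alb : has_lbound A.
  exists (- ((kappa / 2)^-1 * ip g g)) => _ [f Sf <-].
  apply: le_trans (Elow f Sf); have := ip_ge0 f => f0.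
  have : 0 <= kappa / 2 * ip f f by apply: mulr_ge0 => //; lra.
  lra.
have hA : has_inf A.
  by split => //; exists (energy w c g (fun=> 0)); exists (fun=> 0) => //; exact: orth0.
have jE f : orth S f -> inf A <= energy w c g f.
  by move=> Sf; apply: ge_inf => //; exists f.
have /choice[f_ hf] : forall n, exists f, orth S f /\ energy w c g f <= inf A + n.+1%:R^-1.
  move=> n; have n0 : 0 < n.+1%:R^-1 :> R by rewrite invr_gt0.
  by have [_ [f Sf <-] /ltW fle] := inf_adherent n0 hA; exists f.
(* The norm bound that [Elow] gives for energies at most [inf A + 1]. *)
pose M := (kappa / 2)^-1 * (inf A + 1 + (kappa / 2)^-1 * ip g g).
have [|f [Sf ef _]] := energy_attained gw lw delta0 cd (M := M) eS Sg jE (f_ := f_).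
  move=> n; have [Sf fle] := hf n; split => //.
  rewrite /M ler_pdivlMl; last by lra.
  have : n.+1%:R^-1 <= 1 :> R by rewrite invf_le1 ?ler1n.
  have := Elow _ Sf; move: fle; set q := n.+1%:R^-1; set z := (kappa / 2)^-1 * _; lra.
by exists f.
Qed.

Variables m delta : R.
Hypothesis delta0 : 0 < delta.
Hypothesis md : forall x, I01 x -> m + delta <= d x.
Hypothesis m0 : m != 0.
Hypothesis minm : forall h, L2 h -> Int h = 0 -> m * ip h h <= ip (lap w h) h.
Variable f0 : R -> R.
Hypothesis ef0 : eigfun w m f0.
Hypothesis nf0 : ~ ae_zero f0.
Hypothesis simple : forall f, eigfun w m f -> exists c, ae_eq f (fun x => c * f0 x).

Let S2 : set (R -> R) := [set (fun=> 1); f0].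

Let eS2 : eigenfamily w S2.
Proof. by move=> h [->|->]; [exists 0; exact: eigfun_cst1|exists m]. Qed.

Let orthS2 f : orth S2 f <-> [/\ L2 f, Int f = 0 & ip f f0 = 0].
Proof.
split=> [[lf Sf]|[lf f1 ff0]].
- by split => //; [rewrite -ip1E|]; apply: Sf; [left|right].
- by split => // _ [->|->]; rewrite ?ip1E.
Qed.

(** Without a gap, [m] would be attained on the orthogonal of 1 and [f0] by an eigenfunction, which
    [simple] makes a multiple of [f0]: impossible. *)
Let gap : exists e, 0 < e /\
  forall f, orth S2 f -> (m + e) * ip f f <= ip (lap w f) f.
Proof.
apply: contrapT => ngap.
have mS f : orth S2 f -> m * ip f f <= ip (lap w f) f.
  by move=> /orthS2[lf If _]; exact: minm.
have [e e0|f [/orthS2[lf If ff0] ef nf]] := bottom_attained delta0 md eS2 mS.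
  apply: contrapT => nf; apply: ngap; exists e; split => // f Sf.
  have lf : L2 f by case: Sf.
  have [f0'|f0'] := leP (ip f f) 0.
    have -> : ip f f = 0 by apply: le_anti; rewrite f0' ip_ge0.
    have := lap_ip_le gw lw lf; rewrite ler_norml => /andP[+ _].
    have -> : ip f f = 0 by apply: le_anti; rewrite f0' ip_ge0.
    lra.
  by rewrite leNgt; apply/negP => /ltW fle; apply: nf; exists f.
have [c fc] := simple ef.
have lf0 : L2 f0 := ef0.1.
have lc := L2Z c lf0.
have : ip f f = 0.
  rewrite (ip_ae (L2_measurable lf) (L2_measurable lc) (L2_measurable lf) fc).
  by rewrite ipZl// ipC ff0 mulr0.
by have := ip_gt0 lf nf => /[swap] ->; rewrite ltxx.
Qed.

Lemma bottom_isolated : isolated_fin_eigenvalue w m.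
Proof.
split; first by exists f0.
split; last first.
  exists [:: f0] => f /simple[c fc]; exists [:: c].
  by rewrite /ae_eq; apply: (ae_mono fc) => x _ ->; rewrite big_ord1.
have [e [e0 coer]] := gap.
have lf0 : L2 f0 := ef0.1.
have n0 := ip_gt0 lf0 nf0.
(* [e] keeps [mu] below the gap, [delta] keeps it below the degrees and the absolute value of [m]
   keeps it away from 0. *)
pose r := Num.min e (Num.min delta `|m|).
have [r0 re rd rm] : [/\ 0 < r, r <= e, r <= delta & r <= `|m|].
  by rewrite /r !lt_min !ge_min !lexx !orbT e0 delta0 normr_gt0 m0.
exists r; split => // mu smu mur; apply: contrapT => mum; apply: smu.
have mu0 : mu != 0.
  by apply/eqP => mu0; move: mur; rewrite mu0 sub0r normrN ltNge rm.
move: mur; rewrite ltr_norml => /andP[mu1 mu2].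
have k0 : 0 < m + e - mu by lra.
have mmu : m - mu != 0 by apply/eqP => ?; apply: mum; lra.
have coer' f : orth S2 f -> (mu + (m + e - mu)) * ip f f <= ip (lap w f) f.
  by have -> : mu + (m + e - mu) = m + e by [ring]; exact: coer.
split; last first.
  move=> f lf f0'.
  have ef : eigfun w mu f.
    by split => //; rewrite /ae_eq; apply: (ae_mono f0') => x _; lra.
  have If := eigfun_Int0 gw lw mu0 ef.
  (* Symmetry of [L] gives [(m - mu) * ip f f0 = 0]. *)
  have ff0 : ip f f0 = 0.
    have := eigfun_ip ef lf0; rewrite (lap_sym gw lw)// ipC (eigfun_ip ef0)//.
    rewrite (ipC f0) => /eqP; rewrite -subr_eq0 -mulrBl mulf_eq0 (negbTE mmu).
    by move/eqP.
  have := coer' f ((orthS2 f).2 (And3 lf If ff0)); rewrite (eigfun_ip ef lf).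
  have := ip_ge0 f => ff ffle; apply: ip_eq0 => //; apply: le_anti.
  rewrite ff andbT -(pmulr_rle0 _ k0); lra.
move=> g lg.
have If0 := eigfun_Int0 gw lw m0 ef0.
pose a := Int g; pose b := ip g f0 / ip f0 f0.
have l1 : L2 (fun=> 1 : R) by exact: L2_cst.
pose p x := a * 1 + b * f0 x.
have lp : L2 p by exact: L2_lin.
have i11 : ip (fun=> 1) (fun=> 1) = 1 :> R by rewrite ip1E Int_cst.
have Sg : orth S2 (fun x => g x - p x).
  apply/orthS2; split; first exact: L2B.
  - rewrite -ip1E ipBl// /p ip_lin// i11 !ip1E If0 -/a; ring.
  - rewrite ipBl// /p ip_lin// (ipC (fun=> 1)) ip1E If0 /b mulr0 add0r divfK ?subrr//.
    by rewrite gt_eqF.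
have [|x xI|f [Sf ef]] := @solve_coercive S2 mu (delta - (mu - m)) (m + e - mu) _ _ _ k0 eS2 coer' Sg.
- by lra.
- by have := md xI; lra.
have lf : L2 f by case: Sf.
(* [L - mu] multiplies 1 by [- mu] and [f0] by [m - mu], so the projection [p] of [g] is inverted by
   hand and [f] handles the orthogonal part. *)
pose h x := 1 * f x + 1 * ((- (a / mu)) * 1 + (b / (m - mu)) * f0 x).
have lq : L2 (fun x => (- (a / mu)) * 1 + (b / (m - mu)) * f0 x) by exact: L2_lin.
exists h; split; first exact: L2_lin.
rewrite /ae_eq; apply: (ae_mono ef0.2) => x xI fx.
rewrite /h !(lap_lin gw lw) ?L2_itg// fx (lap_cst _ _ xI).
have := ef x xI; rewrite /p => fE.
have -> : lap w f x = g x - (a * 1 + b * f0 x) + mu * f x by lra.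
by field; rewrite mu0 mmu.
Qed.

End SpectralGap.

(** * Identification of the Fiedler value with the bottom [m] *)

Lemma Hset_orth (R : realType) (f : R -> R) :
  Hset f <-> orth [set (fun=> 1)] f /\ ip f f = 1.
Proof.
have sq : ip f f = \int[lebesgue_measure]_(x in @I01 R) (f x ^+ 2).
  by apply: eq_Int => x _; rewrite expr2.
rewrite sq /Hset; split=> [[lf [If f1]]|[[lf Sf] f1]].
- by split => //; split => // _ ->; rewrite ip1E.
- by split => //; split => //; have := Sf _ erefl; rewrite ip1E.
Qed.

Theorem mainTheorem3 (R : realType) (w : R -> R -> R) (lam : R) :
  graphon w -> robinsonian w -> A1 w -> A2 w -> A3 w -> A4 w ->
  fiedler_value w lam -> eigenspace_dim1 w lam.
Proof.
move=> gw rw [K [_ lw]] a2 _ a4 [_ [lam0 [[[g [eg ng]] _] lam_least]]].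
pose S : set (R -> R) := [set (fun=> 1)].
have eS : eigenfamily w S by move=> _ ->; exists 0; exact: eigfun_cst1.
pose Q := [set ip (lap w f) f | f in @Hset R].
pose m := inf Q.
have Ig : Int g = 0 by apply: (eigfun_Int0 gw lw _ eg); rewrite gt_eqF.
have lg : L2 g := eg.1.
have g0 := ip_gt0 lg ng.
have Sg : orth S g by split => // _ ->; rewrite ip1E.
(* [inf] is meaningful only for a nonempty set bounded below: the eigenfunction [g], normalized,
   provides an element and [lap_ip_le] the bound -2. *)
have hQ : has_inf Q.
  split.
    have [h [Sh h1 _]] := normalize gw lw Sg g0 eS.
    by exists (ip (lap w h) h), h => //; apply/Hset_orth.
  exists (-2) => _ [f /Hset_orth[[lf _] f1] <-].
  by have := lap_ip_le gw lw lf; rewrite f1 ler_norml => /andP[+ _]; lra.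
have minS f : orth S f -> m * ip f f <= ip (lap w f) f.
  move=> Sf; have lf : L2 f by case: Sf.
  have [f0|f0] := leP (ip f f) 0.
    have ff : ip f f = 0 by apply: le_anti; rewrite f0 ip_ge0.
    by have := lap_ip_le gw lw lf; rewrite ff ler_norml => /andP[+ _]; lra.
  have [h [Sh h1 hE]] := normalize gw lw Sf f0 eS.
  rewrite -ler_pdivlMr// -hE; apply: ge_inf; first exact: hQ.2.
  by exists h => //; apply/Hset_orth.
have minm h : L2 h -> Int h = 0 -> m * ip h h <= ip (lap w h) h.
  by move=> lh Ih; apply: minS; split => // _ ->; rewrite ip1E.
pose delta := inf [set degree w x | x in @I01 R] - m.
have delta0 : 0 < delta by rewrite subr_gt0; exact: a4.
have md x : I01 x -> m + delta <= degree w x.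
  move=> xI; rewrite /delta addrC subrK; apply: ge_inf; last by exists x.
  by exists 0 => _ [y yI <-]; exact: degree_ge0.
have [e e0|f0 [Sf0 ef0 nf0]] := bottom_attained gw lw delta0 md eS minS.
  have [_ [f /Hset_orth[Sf f1] <-] /ltW fle] := inf_adherent e0 hQ.
  by exists f; split => //; rewrite f1 ?mulr1.
have If0 : Int f0 = 0 by rewrite -ip1E; apply: Sf0.2.
have m0 := bottom_neq0 gw a2 lw delta0 md ef0 If0 nf0.
have simple := eigfun_proportional gw a2 lw delta0 md rw minm m0 ef0 nf0.
have iso := bottom_isolated gw lw delta0 md m0 minm ef0 nf0 simple.
have mlam : m <= lam.
  by have := minm _ lg Ig; rewrite (eigfun_ip gw lw eg lg) ler_pM2r.
(* If [m < lam], minimality of [lam] among the nonzero isolated eigenvalues would give [m = 0]. *)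
have -> : lam = m.
  apply/eqP; rewrite eq_le mlam andbT leNgt; apply/negP => /(lam_least _ iso) e.
  by move: m0; rewrite e eqxx.
by exists f0.
Qed.
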